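(* Let $\nu\ge0$, $\alpha>-1$, and let $P_n^{\nu,\alpha}$ be the orthonormal polynomials with positive leading coefficients with respect to $x^\alpha\rho_\nu(x)\,dx$ on $(0,\infty)$. Then for $n\in\mathbb{N}_0$ and $x>0$ the Rodrigues type formula $$P_n^{\nu,\alpha}(x)=\frac{x^{-\alpha}}{\rho_\nu(x)}\frac{d^n}{dx^n}\Bigg[x^{n+\alpha}\Bigg[\rho_\nu(x)\sum_{j=0}^n\sum_{k=0}^j\sum_{m=0}^k\sum_{i=0}^{[m/2]}\frac{(-1)^{k+m}}{(j+n)!}c_{n,j+n}(n+\nu+\alpha+k+1)_{j-k}(\nu+i-m+1)_{m-2i}(m-2i+1)_i(\nu)_{k-m}\binom{j}{k}\binom{k}{m}\frac{x^i}{i!}$$ $$+\rho_{\nu+1}(x)\sum_{j=0}^n\sum_{k=0}^j\sum_{m=0}^{k-1}\sum_{i=0}^{[m/2]}\frac{(-1)^{k+m}}{(j+n)!}c_{n,j+n}(n+\nu+\alpha+k+1)_{j-k}(\nu+i-m)_{m-2i}(m-2i+1)_i(\nu)_{k-m-1}\binom{j}{k}\binom{k}{m+1}\frac{x^i}{i!}\Bigg]\Bigg]$$ holds. Moreover, $$P_{2n}^{\nu,\alpha}(x)=\sum_{j=n}^{2n}\frac{c_{2n,2j}}{(2j)!}A^\alpha_{j,j-1}(x)+\sum_{j=n}^{2n-1}\frac{c_{2n,2j+1}}{(2j+1)!}A^\alpha_{j,j}(x),$$ $$P_{2n+1}^{\nu,\alpha}(x)=\sum_{j=n}^{2n}\Big[\frac{c_{2n+1,2(j+1)}}{(2(j+1))!}A^\alpha_{j+1,j}(x)+\frac{c_{2n+1,2j+1}}{(2j+1)!}A^\alpha_{j,j}(x)\Big],$$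 where $$A^\alpha_{j,j-1}(x)=(\alpha+1)_{2j}\sum_{m=0}^j\binom{2j}{2m}\frac{x^m}{(\alpha+1)_{2m}}\,{}_3F_2\big(-2(j-m),\,m-\nu,\,m+1;\,2m+1+\alpha,\,2m+1;\,1\big),$$ $$A^\alpha_{j,j}(x)=(\alpha+1)_{2j+1}\sum_{m=0}^j\binom{2j+1}{2m}\frac{x^m}{(\alpha+1)_{2m}}\,{}_3F_2\big(-2(j-m)-1,\,m-\nu,\,m+1;\,2m+1+\alpha,\,2m+1;\,1\big).$$
   Context: For $\nu\in\mathbb{R}$, $x>0$, $\rho_\nu(x)=2x^{\nu/2}K_\nu(2\sqrt{x})$ with $K_\nu$ the modified Bessel function of the second kind. The $P_n^{\nu,\alpha}(x)=\sum_{k=0}^na_{n,k}x^k$ satisfy $\int_0^\infty P_n^{\nu,\alpha}P_m^{\nu,\alpha}x^\alpha\rho_\nu\,dx=\delta_{n,m}$. $(s)_n=s(s+1)\cdots(s+n-1)$ is the Pochhammer symbol, $[\cdot]$ the integer part, ${}_3F_2$ the generalized hypergeometric function, $L_k^\beta$ the associated Laguerre polynomial. The associated polynomial of $P_n^{\nu,\alpha}$ is $Q_{2n}(x)=\sum_{k=0}^na_{n,k}(-1)^kk!\,x^kL_k^\nu(x)$, and the coefficients $c_{n,k}$ are $$c_{n,k}=\frac{k!}{\Gamma(k+\nu+\alpha+1)}\int_0^\infty t^{\nu+\alpha}e^{-t}Q_{2n}(t)L_k^{\nu+\alpha}(t)\,dt,$$ i.e. the coefficients in $Q_{2n}=\sum_{k=0}^{2n}c_{n,k}L_k^{\nu+\alpha}$.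 *)

(* Defs.v *)
From Stdlib Require Import Reals Factorial.
From Coquelicot Require Import Coquelicot.
Open Scope R_scope.

Fixpoint sumR (n : nat) (f : nat -> R) : R :=
  match n with O => 0 | S k => sumR k f + f k end.

Fixpoint poch (s : R) (n : nat) : R :=
  match n with O => 1 | S k => poch s k * (s + INR k) end.

(* real binomial coefficient C(n,k), n,k naturals, k <= n in all uses *)
Definition binom (n k : nat) : R := Binomial.C n k.

Definition Gamma (s : R) : R :=
  RInt_gen (fun t => Rpower t (s - 1) * exp (- t)) (at_right 0) (Rbar_locally p_infty).

Definition BesselK (nu x : R) : R :=
  RInt_gen (fun t => exp (- x * cosh t) * cosh (nu * t)) (at_point 0) (Rbar_locally p_infty).

Definition rho (nu x : R) : R := 2 * Rpower x (nu / 2) * BesselK nu (2 * sqrt x).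

Definition Laguerre (k : nat) (beta x : R) : R :=
  sumR (S k) (fun i => (-1) ^ i * (poch (beta + INR i + 1) (k - i) / INR (fact (k - i)))
                       * x ^ i / INR (fact i)).

Definition polyP (a : nat -> nat -> R) (n : nat) (x : R) : R :=
  sumR (S n) (fun k => a n k * x ^ k).

Definition Qassoc (a : nat -> nat -> R) (nu : R) (n : nat) (x : R) : R :=
  sumR (S n) (fun k => a n k * (-1) ^ k * INR (fact k) * x ^ k * Laguerre k nu x).

Definition cnk (a : nat -> nat -> R) (nu alpha : R) (n k : nat) : R :=
  INR (fact k) / Gamma (INR k + nu + alpha + 1) *
  RInt_gen (fun t => Rpower t (nu + alpha) * exp (- t) * Qassoc a nu n t
                      * Laguerre k (nu + alpha) t)
           (at_right 0) (Rbar_locally p_infty).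

Definition F32_term (N : nat) (a2 a3 b1 b2 : R) : R :=
  sumR (S N) (fun s => poch (- INR N) s * poch a2 s * poch a3 s
                        / (poch b1 s * poch b2 s * INR (fact s))).

Definition A_jjm1 (nu alpha : R) (j : nat) (x : R) : R :=
  poch (alpha + 1) (2 * j) *
  sumR (S j) (fun m => binom (2 * j) (2 * m) * x ^ m / poch (alpha + 1) (2 * m)
     * F32_term (2 * (j - m)) (INR m - nu) (INR m + 1)
                (2 * INR m + 1 + alpha) (2 * INR m + 1)).

Definition A_jj (nu alpha : R) (j : nat) (x : R) : R :=
  poch (alpha + 1) (2 * j + 1) *
  sumR (S j) (fun m => binom (2 * j + 1) (2 * m) * x ^ m / poch (alpha + 1) (2 * m)
     * F32_term (2 * (j - m) + 1) (INR m - nu) (INR m + 1)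
                (2 * INR m + 1 + alpha) (2 * INR m + 1)).

Definition S1 (a : nat -> nat -> R) (nu alpha : R) (n : nat) (x : R) : R :=
  sumR (S n) (fun j => sumR (S j) (fun k => sumR (S k) (fun m =>
   sumR (S (m / 2)) (fun i =>
     (-1) ^ (k + m) / INR (fact (j + n)) * cnk a nu alpha n (j + n)
     * poch (INR n + nu + alpha + INR k + 1) (j - k)
     * poch (nu + INR i - INR m + 1) (m - 2 * i)
     * poch (INR (m - 2 * i) + 1) i
     * poch nu (k - m)
     * binom j k * binom k m * x ^ i / INR (fact i))))).

Definition S2 (a : nat -> nat -> R) (nu alpha : R) (n : nat) (x : R) : R :=
  sumR (S n) (fun j => sumR (S j) (fun k => sumR k (fun m =>
   sumR (S (m / 2)) (fun i =>
     (-1) ^ (k + m) / INR (fact (j + n)) * cnk a nu alpha n (j + n)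
     * poch (INR n + nu + alpha + INR k + 1) (j - k)
     * poch (nu + INR i - INR m) (m - 2 * i)
     * poch (INR (m - 2 * i) + 1) i
     * poch nu (k - m - 1)
     * binom j k * binom k (m + 1) * x ^ i / INR (fact i))))).

(* Main.v *)
Require Import Defs.
From Stdlib Require Import Reals Factorial Lra Lia ZArith Arith.
From Coquelicot Require Import Coquelicot.
Open Scope R_scope.

(** The functions [rho_mu] satisfy [rho_{mu+1} = mu rho_mu + x rho_{mu-1}] and
    [rho_mu' = - rho_{mu-1}].  Hence [t^i |-> rho_{nu+i}(x)] extends to a linear map on
    polynomials in [t] that sends [(-1)^k k! t^k L_k^nu] to [x^k rho_nu] and
    [k! L_k^{nu+alpha}] to [x^{-alpha} (x^{k+alpha} rho_nu)^{(k)}].  Applied to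
    [Q_{2n} = sum_k c_{n,k} L_k^{nu+alpha}] it gives
    [x^alpha rho_nu P_n = sum_k c_{n,k}/k! (x^{k+alpha} rho_nu)^{(k)}], and orthogonality of
    [P_n], expressed through the moments of [x^alpha rho_nu], makes [c_{n,k}] vanish for [k < n].
    This identity uses only the index recurrence, so it holds for every solution of that
    recurrence: the solution [rho_{nu+z}(x)] yields the Rodrigues formula, the one with
    initial values [1, 0] yields the expansion in the polynomials [A]. *)

(** Multiplication by x raises the index of [rho] and differentiation lowers it; both iterated
    operations have the numbers [lag] as coefficients, so the sequences are indexed by all integers.
    The triangular matrix [lag] is its own inverse, hence the expansion of Q_{2n} in Laguerre
    polynomials is finite algebra, valid under any linear functional. The vanishing of c_{n,k} for k
    < n rests on one comparison of moments: once both weights have mass 1, (alpha+1)_i times the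
    integral of t^i Q_{2n} against t^{nu+alpha} e^{-t} equals the integral of x^i P_n against
    x^alpha rho_nu. Pairing Q_{2n} with L_k^{nu+alpha} involves only i <= k, where P_n is orthogonal
    to x^i. Almost every collapse of a sum is the Chu-Vandermonde identity. The total mass of
    x^alpha rho_nu is never evaluated: it is read off from the normalisation of P_0. In the
    Rodrigues formula only j of the k = n + j derivatives are carried out inside the bracket;
    Leibniz' rule there produces rho_{nu-p}, which descends to rho_nu and rho_{nu+1} with
    Lommel-type polynomials as coefficients. *)

(** * Finite sums *)

Lemma sumR_ext n f g : (forall i, (i < n)%nat -> f i = g i) -> sumR n f = sumR n g.
Proof.
  induction n as [|n IH]; intros H; simpl; [reflexivity|].
  rewrite IH, H by (intros; try apply H; lia); reflexivity.
Qed.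

Lemma sumR_plus n f g : sumR n (fun i => f i + g i) = sumR n f + sumR n g.
Proof. induction n as [|n IH]; simpl; [ring|rewrite IH; ring]. Qed.

Lemma sumR_scal n c f : sumR n (fun i => c * f i) = c * sumR n f.
Proof. induction n as [|n IH]; simpl; [ring|rewrite IH; ring]. Qed.

Lemma sumR_zero n f : (forall i, (i < n)%nat -> f i = 0) -> sumR n f = 0.
Proof.
  induction n as [|n IH]; intros H; simpl; [reflexivity|].
  rewrite IH, H by (intros; try apply H; lia); ring.
Qed.

Lemma sumR_swap n m f :
  sumR n (fun i => sumR m (fun j => f i j)) = sumR m (fun j => sumR n (fun i => f i j)).
Proof.
  induction n as [|n IH]; simpl.
  - symmetry; now apply sumR_zero.
  - now rewrite IH, sumR_plus.
Qed.

Lemma sumR_first n f : sumR (S n) f = f 0%nat + sumR n (fun i => f (S i)).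
Proof. induction n as [|n IH]; simpl in *; [ring|rewrite IH; ring]. Qed.

Lemma sumR_app n m f : sumR (n + m) f = sumR n f + sumR m (fun i => f (n + i)%nat).
Proof.
  induction m as [|m IH]; [rewrite Nat.add_0_r; simpl; ring|].
  rewrite Nat.add_succ_r; simpl; rewrite IH; ring.
Qed.

Lemma sumR_extend n m f : (n <= m)%nat ->
  (forall i, (n <= i < m)%nat -> f i = 0) -> sumR m f = sumR n f.
Proof.
  intros H H0; replace m with (n + (m - n))%nat by lia.
  rewrite sumR_app, (sumR_zero (m - n)); [ring|].
  intros i Hi; apply H0; lia.
Qed.

(** * Pochhammer symbols, binomial coefficients and the Chu-Vandermonde sum *)

Lemma poch_last s n : poch s (S n) = poch s n * (s + INR n).
Proof. reflexivity. Qed.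

Lemma poch_first s n : poch s (S n) = s * poch (s + 1) n.
Proof.
  induction n as [|n IH]; [simpl; ring|].
  change (poch s (S (S n))) with (poch s (S n) * (s + INR (S n))).
  rewrite IH; simpl poch; rewrite S_INR; ring.
Qed.

Lemma poch_add s n m : poch s (n + m) = poch s n * poch (s + INR n) m.
Proof.
  induction m as [|m IH]; [rewrite Nat.add_0_r; simpl; ring|].
  rewrite Nat.add_succ_r; simpl; rewrite IH, plus_INR; ring.
Qed.

Lemma poch_pos s n : 0 < s -> 0 < poch s n.
Proof.
  intros Hs; induction n as [|n IH]; simpl; [lra|].
  apply Rmult_lt_0_compat; [assumption|pose proof (pos_INR n); lra].
Qed.

(* Pascal's recursion, so that [bin n k = 0] for [k > n], unlike [Binomial.C]. *)
Fixpoint bin (n k : nat) : R :=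
  match n, k with
  | _, O => 1
  | O, S _ => 0
  | S n', S k' => bin n' k' + bin n' k
  end.

Lemma bin_0 n : bin n 0 = 1.
Proof. now destruct n. Qed.

Lemma bin_gt n : forall k, (n < k)%nat -> bin n k = 0.
Proof.
  induction n as [|n IH]; intros [|k] H; try lia; simpl; [reflexivity|].
  rewrite !IH by lia; ring.
Qed.

Lemma bin_diag n : bin n n = 1.
Proof. induction n as [|n IH]; simpl; [|rewrite IH, bin_gt by lia]; ring. Qed.

Lemma bin_absorb n : forall k, INR (S k) * bin n (S k) = (INR n - INR k) * bin n k.
Proof.
  induction n as [|n IH]; intros [|k].
  - simpl; ring.
  - simpl; ring.
  - change (bin (S n) 1) with (bin n 0 + bin n 1).
    specialize (IH 0%nat); rewrite (S_INR n), !bin_0 in *; simpl INR in *; lra.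
  - change (bin (S n) (S (S k))) with (bin n (S k) + bin n (S (S k))).
    change (bin (S n) (S k)) with (bin n k + bin n (S k)).
    pose proof (IH k) as H1; pose proof (IH (S k)) as H2.
    rewrite Rmult_plus_distr_l, H2, !S_INR in *; lra.
Qed.

Lemma binom_bin n : forall k, (k <= n)%nat -> binom n k = bin n k.
Proof.
  unfold binom; induction n as [|n IH]; intros [|k] H; try lia.
  - unfold Binomial.C; simpl; field.
  - rewrite bin_0; unfold Binomial.C; simpl Nat.sub; simpl (fact 0); rewrite INR_1.
    field; apply INR_fact_neq_0.
  - destruct (Nat.eq_dec k n) as [->|Hk].
    + rewrite bin_diag; unfold Binomial.C; rewrite Nat.sub_diag; simpl (fact 0); rewrite INR_1.
      field; apply INR_fact_neq_0.
    + simpl bin; rewrite <- !IH, pascal by lia; reflexivity.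
Qed.

Lemma bin_fact n k : (k <= n)%nat ->
  bin n k * (INR (fact k) * INR (fact (n - k))) = INR (fact n).
Proof.
  intros H; rewrite <- binom_bin by assumption; unfold binom, Binomial.C.
  field; split; apply INR_fact_neq_0.
Qed.

Lemma bin_trinomial m k i : (i <= k <= m)%nat ->
  bin m k * bin k i = bin m i * bin (m - i) (k - i).
Proof.
  intros H.
  pose proof (bin_fact m k ltac:(lia)) as H1.
  pose proof (bin_fact k i ltac:(lia)) as H2.
  pose proof (bin_fact m i ltac:(lia)) as H3.
  pose proof (bin_fact (m - i) (k - i) ltac:(lia)) as H4.
  replace (m - i - (k - i))%nat with (m - k)%nat in H4 by lia.
  pose proof (INR_fact_neq_0 k); pose proof (INR_fact_neq_0 i).
  pose proof (INR_fact_neq_0 (m - k)); pose proof (INR_fact_neq_0 (k - i)).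
  pose proof (INR_fact_neq_0 (m - i)).
  apply (Rmult_eq_reg_r (INR (fact k) * INR (fact i) * INR (fact (m - k))
    * INR (fact (k - i)) * INR (fact (m - i)))).
  2: repeat apply Rmult_integral_contrapositive_currified; assumption.
  transitivity ((bin m k * (INR (fact k) * INR (fact (m - k))))
    * (bin k i * (INR (fact i) * INR (fact (k - i)))) * INR (fact (m - i))); [ring|].
  rewrite H1, H2.
  transitivity ((bin m i * (INR (fact i) * INR (fact (m - i))))
    * (bin (m - i) (k - i) * (INR (fact (k - i)) * INR (fact (m - k)))) * INR (fact k)); [|ring].
  rewrite H3, H4; ring.
Qed.

(** Chu-Vandermonde, stated without quotients so that it holds for all real a and b. Induction on J
    through Pascal's rule. *)
Lemma vandermonde J : forall a b,
  sumR (S J) (fun q => (-1) ^ q * bin J q * poch a q * poch (b + INR q) (J - q))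
  = poch (b - a) J.
Proof.
  induction J as [|J IH]; intros a b; [simpl; ring|].
  rewrite poch_first.
  replace (b - a + 1) with (b + 1 - a) by ring.
  rewrite <- IH, <- sumR_scal, sumR_first.
  rewrite (sumR_ext (S J) _ (fun q =>
     - ((-1) ^ q * bin J q * poch a q * (a + INR q) * poch (b + 1 + INR q) (J - q))
     + (-1) ^ (S q) * bin J (S q) * poch a (S q) * poch (b + INR (S q)) (J - q))).
  2:{ intros q Hq; change (bin (S J) (S q)) with (bin J q + bin J (S q)).
      change (poch a (S q)) with (poch a q * (a + INR q)); rewrite S_INR.
      replace (S J - S q)%nat with (J - q)%nat by lia.
      replace (b + (INR q + 1)) with (b + 1 + INR q) by ring; simpl pow; ring. }
  rewrite sumR_plus.
  set (h := fun q => (-1) ^ q * bin J q * poch a q * poch (b + INR q) (S J - q)).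
  assert (E : sumR (S (S J)) h = sumR (S J) h).
  { apply sumR_extend; [lia|]; intros i Hi; unfold h; rewrite bin_gt by lia; ring. }
  rewrite sumR_first in E.
  replace ((-1) ^ 0 * bin (S J) 0 * poch a 0 * poch (b + INR 0) (S J - 0)) with (h 0%nat)
    by (unfold h; rewrite !bin_0; reflexivity).
  change (fun q => (-1) ^ S q * bin J (S q) * poch a (S q) * poch (b + INR (S q)) (J - q))
    with (fun q => h (S q)).
  transitivity (sumR (S J) h + sumR (S J) (fun q =>
     - ((-1) ^ q * bin J q * poch a q * (a + INR q) * poch (b + 1 + INR q) (J - q)))); [lra|].
  (* Termwise, the two factors b + q and a + q combine to (b + q) - (a + q) = b - a. *)
  rewrite <- sumR_plus; apply sumR_ext; intros q Hq; unfold h.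
  rewrite Nat.sub_succ_l, poch_first by lia.
  replace (b + INR q + 1) with (b + 1 + INR q) by ring; ring.
Qed.

(** After C(m,k) C(k,i) = C(m,i) C(m-i,k-i), this is Chu-Vandermonde in q = k - i. The case a = b
    inverts the Laguerre matrix; the general case changes the factorisation in Leibniz' rule. *)
Lemma vandermonde_trinomial m i a b : (i <= m)%nat ->
  sumR (S m) (fun k => (-1) ^ (k + i) * bin m k * bin k i * poch a (k - i)
                       * poch (b + INR (k - i)) (m - k))
  = bin m i * poch (b - a) (m - i).
Proof.
  intros H; rewrite <- vandermonde, <- sumR_scal.
  replace (S m) with (i + S (m - i))%nat by lia; rewrite sumR_app, sumR_zero.
  2:{ intros k Hk; rewrite (bin_gt k i) by lia; ring. }
  rewrite Rplus_0_l; apply sumR_ext; intros q Hq.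
  replace (i + q - i)%nat with q by lia.
  replace (m - (i + q))%nat with (m - i - q)%nat by lia.
  transitivity ((-1) ^ (i + q + i) * (bin m (i + q) * bin (i + q) i) * poch a q
     * poch (b + INR q) (m - i - q)); [ring|].
  rewrite bin_trinomial by lia; replace (i + q - i)%nat with q by lia.
  replace ((-1) ^ (i + q + i)) with ((-1) ^ q); [ring|].
  replace (i + q + i)%nat with (2 * i + q)%nat by lia.
  rewrite pow_add, pow_1_even; ring.
Qed.

(* Coefficient of [x ^ i] in [k! L_k^b]. *)
Definition lag (b : R) (k i : nat) : R := (-1) ^ i * bin k i * poch (b + INR i + 1) (k - i).

Lemma lag_gt b k i : (k < i)%nat -> lag b k i = 0.
Proof. intros H; unfold lag; rewrite bin_gt by assumption; ring. Qed.

Lemma lag_Laguerre k b x :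
  INR (fact k) * Laguerre k b x = sumR (S k) (fun i => lag b k i * x ^ i).
Proof.
  unfold Laguerre; rewrite <- sumR_scal; apply sumR_ext; intros i Hi; unfold lag.
  rewrite <- (bin_fact k i) by lia; field; split; apply INR_fact_neq_0.
Qed.

(** * Recurrences of the Laguerre coefficients and their inversion *)

(** With [lag_S_S] this is the operator identity (k+1)! L_{k+1}^b = (x d/dx + b + 1 - x) k!
    L_k^{b+1}, read coefficient by coefficient. *)
Lemma lag_S_0 b k : lag b (S k) 0 = (b + 1) * lag (b + 1) k 0.
Proof.
  unfold lag; rewrite !bin_0, !Nat.sub_0_r, poch_first; simpl INR.
  replace (b + 0 + 1 + 1) with (b + 1 + 0 + 1) by ring; ring.
Qed.

Lemma lag_S_S b k i :
  lag b (S k) (S i) = (b + 1 + INR (S i)) * lag (b + 1) k (S i) - lag (b + 1) k i.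
Proof.
  unfold lag; change (bin (S k) (S i)) with (bin k i + bin k (S i)).
  replace (S k - S i)%nat with (k - i)%nat by lia.
  replace (b + INR (S i) + 1) with (b + 1 + INR i + 1) by (rewrite S_INR; ring).
  destruct (Nat.le_gt_cases k i) as [H|H].
  - rewrite (bin_gt k (S i)) by lia; simpl pow; ring.
  - replace (k - i)%nat with (S (k - S i)) by lia; rewrite poch_first.
    replace (b + 1 + INR i + 1 + 1) with (b + 1 + INR (S i) + 1) by (rewrite S_INR; ring).
    rewrite S_INR; simpl pow; ring.
Qed.

(** With [lag_S_S_last]: (k+1)! L_{k+1}^b = (x d/dx + b + k + 1 - x) k! L_k^b. This variant keeps
    the parameter b fixed. *)
Lemma lag_S_0_last b k : lag b (S k) 0 = (b + INR k + 1) * lag b k 0.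
Proof. unfold lag; rewrite !bin_0, !Nat.sub_0_r; simpl; ring. Qed.

Lemma lag_S_S_last b k i :
  lag b (S k) (S i) = (b + INR k + 1 + INR (S i)) * lag b k (S i) - lag b k i.
Proof.
  unfold lag; change (bin (S k) (S i)) with (bin k i + bin k (S i)).
  replace (S k - S i)%nat with (k - i)%nat by lia.
  destruct (Nat.le_gt_cases k i) as [H|H].
  - rewrite (bin_gt k (S i)) by lia; replace (k - i)%nat with 0%nat by lia.
    simpl pow; simpl (poch _ 0); ring.
  - replace (k - i)%nat with (S (k - S i)) by lia; rewrite (poch_last (b + INR (S i) + 1)).
    rewrite (poch_first (b + INR i + 1)).
    replace (b + INR i + 1 + 1) with (b + INR (S i) + 1) by (rewrite S_INR; ring).
    pose proof (bin_absorb k i) as E.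
    rewrite minus_INR by lia; rewrite !S_INR in *; simpl pow.
    assert (E' : INR i * bin k i = INR k * bin k i - (INR i + 1) * bin k (S i)) by lra.
    set (p := poch _ _); clearbody p.
    ring [E'].
Qed.

(** With [lag_S_0]: (k+1)! L_{k+1}^b = (b+1) k! L_k^{b+1} - x k! L_k^{b+2}. *)
Lemma lag_S_S_shift b k i :
  lag b (S k) (S i) = (b + 1) * lag (b + 1) k (S i) - lag (b + 2) k i.
Proof.
  unfold lag; change (bin (S k) (S i)) with (bin k i + bin k (S i)).
  replace (S k - S i)%nat with (k - i)%nat by lia.
  replace (b + INR (S i) + 1) with (b + INR i + 2) by (rewrite S_INR; ring).
  replace (b + 1 + INR (S i) + 1) with (b + INR i + 3) by (rewrite S_INR; ring).
  replace (b + 2 + INR i + 1) with (b + INR i + 3) by ring.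
  destruct (Nat.le_gt_cases k i) as [H|H].
  - rewrite (bin_gt k (S i)) by lia; replace (k - i)%nat with 0%nat by lia.
    simpl pow; simpl (poch _ 0); ring.
  - replace (k - i)%nat with (S (k - S i)) by lia.
    rewrite (poch_first (b + INR i + 2)); rewrite (poch_last (b + INR i + 3)).
    replace (b + INR i + 2 + 1) with (b + INR i + 3) by ring.
    pose proof (bin_absorb k i) as E.
    rewrite minus_INR by lia; rewrite !S_INR in *; simpl pow.
    assert (E' : INR i * bin k i = INR k * bin k i - (INR i + 1) * bin k (S i)) by lra.
    set (p := poch _ _); clearbody p.
    ring [E'].
Qed.

(** The product sum is Chu-Vandermonde with equal parameters, giving C(m,i) (0)_{m-i}, which is
    nonzero only for m = i. *)
Lemma lag_involutive b N m i : (m <= N)%nat ->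
  sumR (S N) (fun k => lag b m k * lag b k i) = if Nat.eqb m i then 1 else 0.
Proof.
  intros HN; rewrite (sumR_extend (S m)) by
    (try lia; intros k Hk; rewrite (lag_gt b m k) by lia; ring).
  destruct (Nat.le_gt_cases i m) as [H|H].
  - transitivity (bin m i * poch (b + INR i + 1 - (b + INR i + 1)) (m - i)).
    + rewrite <- vandermonde_trinomial by assumption; apply sumR_ext; intros k Hk.
      unfold lag; rewrite pow_add.
      destruct (Nat.le_gt_cases i k) as [Hik|Hik].
      * replace (b + INR i + 1 + INR (k - i)) with (b + INR k + 1)
          by (rewrite minus_INR by lia; ring).
        ring.
      * rewrite (bin_gt k i) by lia; ring.
    + rewrite Rminus_diag. destruct (Nat.eqb_spec m i) as [->|Hne].
      * rewrite bin_diag, Nat.sub_diag; simpl; ring.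
      * destruct (m - i)%nat eqn:E; [lia|]; rewrite poch_first; ring.
  - rewrite sumR_zero by (intros k Hk; rewrite (lag_gt b k i) by lia; ring).
    destruct (Nat.eqb_spec m i); [lia|reflexivity].
Qed.

(** Read [phi i] as the value of a linear functional at t^i: this expands t^m in the basis k! L_k^b,
    and self-inverseness makes [lag b m k] the coefficient. *)
Lemma lag_expand b N m (phi : nat -> R) : (m <= N)%nat ->
  phi m = sumR (S N) (fun k => lag b m k * sumR (S k) (fun i => lag b k i * phi i)).
Proof.
  intros HN.
  rewrite (sumR_ext _ _ (fun k => sumR (S N) (fun i => lag b m k * lag b k i * phi i))).
  2:{ intros k Hk; rewrite <- (sumR_extend (S k) (S N)).
      - rewrite <- sumR_scal; apply sumR_ext; intros; ring.
      - lia.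
      - intros i Hi; rewrite lag_gt by lia; ring. }
  rewrite sumR_swap.
  rewrite (sumR_ext _ _ (fun i => phi i * if Nat.eqb m i then 1 else 0)).
  2:{ intros i Hi; rewrite <- (lag_involutive b N) by lia; rewrite <- sumR_scal.
      apply sumR_ext; intros; ring. }
  replace (S N) with (m + S (N - m))%nat by lia.
  rewrite sumR_app, sumR_first, !sumR_zero.
  - rewrite Nat.add_0_r, Nat.eqb_refl; ring.
  - intros i Hi; destruct (Nat.eqb_spec m (m + S i)); [lia|ring].
  - intros i Hi; destruct (Nat.eqb_spec m i); [lia|ring].
Qed.

(* Sequences satisfying the index recurrence of [rho]: [u z] stands for [rho (nu + z) x]. *)
Definition rec_seq (nu x : R) (u : Z -> R) : Prop :=
  forall z, u (z + 1)%Z = (nu + IZR z) * u z + x * u (z - 1)%Z.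

(** * Powers of x and iterated derivatives along a solution of the recurrence *)

Lemma rec_seq_x nu x u z : rec_seq nu x u ->
  x * u z = u (z + 2)%Z - (nu + IZR z + 1) * u (z + 1)%Z.
Proof.
  intros Hu; specialize (Hu (z + 1)%Z); rewrite plus_IZR in Hu.
  replace (z + 1 + 1)%Z with (z + 2)%Z in Hu by ring.
  replace (z + 1 - 1)%Z with z in Hu by ring; lra.
Qed.

(** Each further factor x acts by [rec_seq_x], which matches the fixed-parameter recurrence
    [lag_S_S_last] up to sign. At z = 0 this is why the associated polynomial contains (-1)^k k! x^k
    L_k^nu. *)
Lemma pow_x_rec_seq nu x u k : rec_seq nu x u -> forall z,
  x ^ k * u z = (-1) ^ k
    * sumR (S k) (fun i => lag (nu + IZR z) k i * u (z + Z.of_nat (k + i))%Z).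
Proof.
  intros Hu z; induction k as [|k IH].
  - simpl; unfold lag; simpl; rewrite Z.add_0_r; ring.
  - transitivity (x * (x ^ k * u z)); [simpl; ring|]; rewrite IH.
    set (v := fun i => u (z + Z.of_nat (k + i))%Z).
    assert (Hv : forall i, x * v i = v (S (S i)) - (nu + IZR z + INR k + 1 + INR i) * v (S i)).
    { intros i; unfold v; rewrite (rec_seq_x nu x u _ Hu).
      rewrite plus_IZR, <- INR_IZR_INZ, plus_INR.
      replace (z + Z.of_nat (k + S (S i)))%Z with (z + Z.of_nat (k + i) + 2)%Z by lia.
      replace (z + Z.of_nat (k + S i))%Z with (z + Z.of_nat (k + i) + 1)%Z by lia; ring. }
    rewrite (sumR_ext (S (S k)) _ (fun i => lag (nu + IZR z) (S k) i * v (S i))).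
    2:{ intros i _; unfold v; do 3 f_equal; lia. }
    set (l := lag (nu + IZR z)).
    transitivity ((-1) ^ k * sumR (S k) (fun i => l k i * v (S (S i))
      + - (nu + IZR z + INR k + 1 + INR i) * l k i * v (S i))).
    { transitivity ((-1) ^ k * (x * sumR (S k) (fun i => l k i * v i))); [unfold v; ring|].
      f_equal; rewrite <- sumR_scal; apply sumR_ext; intros i _.
      transitivity (l k i * (x * v i)); [ring|]; rewrite Hv; ring. }
    rewrite sumR_plus.
    rewrite <- (sumR_extend (S k) (S (S k)) (fun i => - (nu + IZR z + INR k + 1 + INR i) * l k i * v (S i))).
    2: lia. 2: intros i Hi; unfold l; rewrite lag_gt by lia; ring.
    rewrite !(sumR_first (S k)).
    rewrite (sumR_ext (S k) (fun i => l (S k) (S i) * _) (fun i =>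
      -1 * (- (nu + IZR z + INR k + 1 + INR (S i)) * l k (S i) * v (S (S i))) + -1 * (l k i * v (S (S i))))).
    2:{ intros i _; unfold l; rewrite lag_S_S_last; ring. }
    rewrite sumR_plus, !sumR_scal; 
    replace (l (S k) 0%nat) with ((nu + IZR z + INR k + 1) * l k 0%nat) by (unfold l; now rewrite lag_S_0_last).
    simpl pow; simpl INR; ring.
Qed.

(** The left side is the Leibniz expansion of a k-fold derivative, with indices going down; the
    right side goes up and shows a Laguerre polynomial of parameter nu + z + al. The induction must
    vary al and z together: [lag_S_S_shift] leads to the pairs (al + 1, z) and (al + 2, z - 1), and
    both have the same sum nu + z + al + 1. *)
Lemma lag_rec_seq nu x u k : rec_seq nu x u -> forall al z,
  sumR (S k) (fun p => lag al k p * (x ^ p * u (z - Z.of_nat p)%Z))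
  = sumR (S k) (fun i => lag (nu + IZR z + al) k i * u (z + Z.of_nat i)%Z).
Proof.
  intros Hu; induction k as [|k IH]; intros al z.
  - simpl; unfold lag; simpl; rewrite Z.add_0_r, Z.sub_0_r; ring.
  - transitivity ((al + 1) * sumR (S k) (fun p => lag (al + 1) k p * (x ^ p * u (z - Z.of_nat p)%Z))
      - x * sumR (S k) (fun p => lag (al + 2) k p * (x ^ p * u (z - 1 - Z.of_nat p)%Z))).
    { rewrite <- (sumR_extend (S k) (S (S k)) (fun p => lag (al + 1) k p * (x ^ p * u (z - Z.of_nat p)%Z))).
      2: lia. 2: intros i Hi; rewrite lag_gt by lia; ring.
      rewrite !(sumR_first (S k)), lag_S_0.
      rewrite (sumR_ext (S k) (fun i => lag al (S k) (S i) * _) (fun p =>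
        (al + 1) * (lag (al + 1) k (S p) * (x ^ S p * u (z - Z.of_nat (S p))%Z))
         + (- x) * (lag (al + 2) k p * (x ^ p * u (z - 1 - Z.of_nat p)%Z)))).
      2:{ intros i _; rewrite lag_S_S_shift.
          replace (z - 1 - Z.of_nat i)%Z with (z - Z.of_nat (S i))%Z by lia; simpl pow; ring. }
      rewrite sumR_plus, !sumR_scal; ring. }
    rewrite !IH, minus_IZR.
    set (be := nu + IZR z + al).
    replace (nu + IZR z + (al + 1)) with (be + 1) by (unfold be; ring).
    replace (nu + (IZR z - 1) + (al + 2)) with (be + 1) by (unfold be; ring).
    transitivity (sumR (S k) (fun i => (be + 1 + INR i) * lag (be + 1) k i * u (z + Z.of_nat i)%Z)
      + sumR (S k) (fun i => - lag (be + 1) k i * u (z + Z.of_nat (S i))%Z)).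
    { unfold Rminus; rewrite <- (Rmult_1_l (x * _)), Ropp_mult_distr_l, <- !sumR_scal, <- !sumR_plus.
      apply sumR_ext; intros i _.
      transitivity ((al + 1) * (lag (be + 1) k i * u (z + Z.of_nat i)%Z)
        - lag (be + 1) k i * (x * u (z - 1 + Z.of_nat i)%Z)); [ring|].
      rewrite (rec_seq_x nu x u _ Hu), plus_IZR, minus_IZR, <- INR_IZR_INZ.
      replace (z - 1 + Z.of_nat i + 2)%Z with (z + Z.of_nat (S i))%Z by lia.
      replace (z - 1 + Z.of_nat i + 1)%Z with (z + Z.of_nat i)%Z by lia.
      replace nu with (be - al - IZR z) by (unfold be; ring); ring. }
    rewrite <- (sumR_extend (S k) (S (S k)) (fun i => (be + 1 + INR i) * lag (be + 1) k i * _)).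
    2: lia. 2: intros i Hi; rewrite lag_gt by lia; ring.
    rewrite !(sumR_first (S k)), Rplus_assoc, <- sumR_plus, lag_S_0.
    f_equal; [simpl INR; ring|].
    apply sumR_ext; intros i _; rewrite lag_S_S; ring.
Qed.

(** * Expansion along solutions of the index recurrence *)

(* The linear functional [t ^ m |-> phi m] applied to [Q_{2n}]. *)
Definition Qlin (a : nat -> nat -> R) (nu : R) (n : nat) (phi : nat -> R) : R :=
  sumR (S n) (fun j => a n j * ((-1) ^ j * sumR (S j) (fun i => lag nu j i * phi (j + i)%nat))).

Lemma Qassoc_Qlin a nu n t : Qassoc a nu n t = Qlin a nu n (pow t).
Proof.
  apply sumR_ext; intros j _.
  transitivity (a n j * ((-1) ^ j * (t ^ j * (INR (fact j) * Laguerre j nu t)))); [ring|].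
  rewrite lag_Laguerre, <- (sumR_scal (S j) (t ^ j)); do 2 f_equal.
  apply sumR_ext; intros i _; rewrite pow_add; ring.
Qed.

Lemma Qlin_ext a nu n phi psi : (forall m, (m <= 2 * n)%nat -> phi m = psi m) ->
  Qlin a nu n phi = Qlin a nu n psi.
Proof.
  intros H; apply sumR_ext; intros j Hj; do 2 f_equal; apply sumR_ext; intros i Hi.
  now rewrite H by lia.
Qed.

Lemma Qlin_plus a nu n phi psi :
  Qlin a nu n (fun m => phi m + psi m) = Qlin a nu n phi + Qlin a nu n psi.
Proof.
  unfold Qlin; rewrite <- sumR_plus; apply sumR_ext; intros j _.
  rewrite <- !Rmult_plus_distr_l, <- sumR_plus; do 2 f_equal.
  apply sumR_ext; intros; ring.
Qed.

Lemma Qlin_scal a nu n c phi :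
  Qlin a nu n (fun m => c * phi m) = c * Qlin a nu n phi.
Proof.
  unfold Qlin; rewrite <- sumR_scal; apply sumR_ext; intros j _.
  rewrite (sumR_ext _ _ (fun i => c * (lag nu j i * phi (j + i)%nat))) by (intros; ring).
  rewrite sumR_scal; ring.
Qed.

Lemma Qlin_sum a nu n N (phi : nat -> nat -> R) :
  Qlin a nu n (fun m => sumR N (fun k => phi k m)) = sumR N (fun k => Qlin a nu n (phi k)).
Proof.
  induction N as [|N IH]; simpl.
  - apply sumR_zero; intros j _; rewrite sumR_zero by (intros; ring); ring.
  - now rewrite Qlin_plus, IH.
Qed.

(** Q_{2n} has degree 2n, so [lag_expand] applies to all its monomials at once; the coefficient of
    k! L_k^b is [Qlin] of the k-th column of [lag]. *)
Lemma Qlin_expand a nu n b phi :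
  Qlin a nu n phi = sumR (S (2 * n)) (fun k =>
    Qlin a nu n (fun m => lag b m k) * sumR (S k) (fun i => lag b k i * phi i)).
Proof.
  transitivity (Qlin a nu n (fun m => sumR (S (2 * n)) (fun k =>
    sumR (S k) (fun i => lag b k i * phi i) * lag b m k))).
  - apply Qlin_ext; intros m Hm; rewrite (lag_expand b (2 * n) m phi) by lia.
    apply sumR_ext; intros; ring.
  - rewrite Qlin_sum; apply sumR_ext; intros k _; rewrite Qlin_scal; ring.
Qed.

(** This property defines the associated polynomial: replacing t^m by u_m turns Q_{2n} into P_n(x)
    u_0. *)
Lemma Qlin_rec_seq a nu n x u : rec_seq nu x u ->
  Qlin a nu n (fun m => u (Z.of_nat m)) = polyP a n x * u 0%Z.
Proof.
  intros Hu; unfold polyP; rewrite Rmult_comm, <- sumR_scal; apply sumR_ext; intros j _.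
  transitivity (a n j * (x ^ j * u 0%Z)); [|ring].
  rewrite (pow_x_rec_seq nu x u j Hu 0), Rplus_0_r; reflexivity.
Qed.

(** For u_z = rho_{nu+z}(x) this is x^{-s} times the k-th derivative of x^{k+s} rho_nu: the p
    derivatives falling on rho_nu give (-1)^p rho_{nu-p}. It is defined for every u so that the same
    expansion also serves the algebraic solution [unit_seq]. *)
Definition leibniz (s : R) (k : nat) (x : R) (u : Z -> R) : R :=
  sumR (S k) (fun p => lag s k p * (x ^ p * u (- Z.of_nat p)%Z)).

Lemma polyP_expand a nu al n x u : rec_seq nu x u ->
  polyP a n x * u 0%Z
  = sumR (S (2 * n)) (fun k => Qlin a nu n (fun m => lag (nu + al) m k) * leibniz al k x u).
Proof.
  intros Hu; rewrite <- (Qlin_rec_seq a nu n x u Hu), (Qlin_expand a nu n (nu + al)).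
  apply sumR_ext; intros k _; f_equal.
  pose proof (lag_rec_seq nu x u k Hu al 0) as H; rewrite Rplus_0_r in H.
  symmetry; exact H.
Qed.

(* Coefficients of the polynomial [R_p] in
   [x^p rho_{mu-p} = R_p(mu) rho_mu + R_{p-1}(mu-1) rho_{mu+1}]. *)
Definition lommel_coef (mu : R) (p i : nat) : R :=
  if Nat.leb (2 * i) p then
    (-1) ^ p * poch (mu + INR i - INR p + 1) (p - 2 * i) * poch (INR (p - 2 * i) + 1) i
      / INR (fact i)
  else 0.

Definition lommel (mu : R) (p : nat) (x : R) : R :=
  sumR (S (p / 2)) (fun i => lommel_coef mu p i * x ^ i).

Lemma lommel_coef_gt mu p i : (p < 2 * i)%nat -> lommel_coef mu p i = 0.
Proof. intros H; unfold lommel_coef; now rewrite (proj2 (Nat.leb_gt _ _) H). Qed.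

Lemma lommel_extend mu p N x : (p / 2 < N)%nat ->
  lommel mu p x = sumR N (fun i => lommel_coef mu p i * x ^ i).
Proof.
  intros H; symmetry; apply sumR_extend; [lia|]; intros i Hi.
  rewrite lommel_coef_gt; [ring|].
  pose proof (Nat.div_mod_eq p 2); pose proof (Nat.mod_upper_bound p 2); lia.
Qed.

Lemma lommel_0 mu x : lommel mu 0 x = 1.
Proof. unfold lommel, lommel_coef; simpl; field. Qed.

Lemma lommel_1 mu x : lommel mu 1 x = - mu.
Proof. unfold lommel, lommel_coef; simpl; field. Qed.

Lemma lommel_coef_SS_0 mu p :
  lommel_coef mu (S (S p)) 0 = - (mu - INR p - 1) * lommel_coef mu (S p) 0.
Proof.
  unfold lommel_coef; simpl Nat.leb; cbv iota; rewrite Nat.mul_0_r, !Nat.sub_0_r, poch_first.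
  replace (mu + INR 0 - INR (S (S p)) + 1 + 1) with (mu + INR 0 - INR (S p) + 1)
    by (rewrite !S_INR; ring).
  rewrite !S_INR; simpl pow; simpl (INR 0); simpl (poch _ 0); simpl (INR (fact 0)); field.
Qed.

Lemma lommel_coef_SS_S mu p i :
  lommel_coef mu (S (S p)) (S i)
  = lommel_coef mu p i - (mu - INR p - 1) * lommel_coef mu (S p) (S i).
Proof.
  unfold lommel_coef.
  destruct (Nat.leb_spec (2 * i) p) as [H|H].
  2:{ rewrite (proj2 (Nat.leb_gt (2 * S i) (S (S p)))) by lia.
      rewrite (proj2 (Nat.leb_gt (2 * S i) (S p))) by lia; ring. }
  rewrite (proj2 (Nat.leb_le (2 * S i) (S (S p)))) by lia.
  replace (S (S p) - 2 * S i)%nat with (p - 2 * i)%nat by lia.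
  pose proof (INR_fact_neq_0 i) as Hf; pose proof (pos_INR i) as Hi.
  rewrite fact_simpl, mult_INR, (poch_last (INR (p - 2 * i) + 1)).
  destruct (Nat.leb_spec (2 * S i) (S p)) as [H1|H1].
  - replace (p - 2 * i)%nat with (S (S p - 2 * S i)) by lia.
    set (J := (S p - 2 * S i)%nat).
    rewrite (poch_first (mu + INR (S i) - INR (S (S p)) + 1)).
    rewrite (poch_last (mu + INR i - INR p + 1)), (poch_first (INR J + 1)).
    replace (mu + INR (S i) - INR (S (S p)) + 1 + 1) with (mu + INR i - INR p + 1)
      by (rewrite !S_INR; ring).
    replace (mu + INR (S i) - INR (S p) + 1) with (mu + INR i - INR p + 1)
      by (rewrite !S_INR; ring).
    replace (INR (S J) + 1) with (INR J + 1 + 1) by (rewrite S_INR; ring).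
    rewrite !S_INR; simpl pow.
    field; lra.
  - replace (p - 2 * i)%nat with 0%nat by lia.
    simpl (poch _ 0); simpl (INR 0).
    rewrite S_INR; simpl pow; field; lra.
Qed.

(** The recurrence obeyed by x^p u_{-p}, which identifies the explicit coefficients with those of
    the descent in [rec_seq_down]. *)
Lemma lommel_SS mu p x :
  lommel mu (S (S p)) x = x * lommel mu p x - (mu - INR p - 1) * lommel mu (S p) x.
Proof.
  pose proof (Nat.Div0.div_le_mono p (S (S p)) 2 ltac:(lia)).
  pose proof (Nat.Div0.div_le_mono (S p) (S (S p)) 2 ltac:(lia)).
  (* The three upper limits depend on the parity of p. Padding with vanishing coefficients makes the
     ranges agree once the constant terms are split off. *)
  rewrite (lommel_extend mu p (S (S p / 2))), (lommel_extend mu (S p) (S (S (S p / 2)))).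
  2,3: pose proof (Nat.div_mod_eq p 2); pose proof (Nat.mod_upper_bound p 2);
       pose proof (Nat.div_mod_eq (S p) 2); pose proof (Nat.mod_upper_bound (S p) 2); lia.
  rewrite (lommel_extend mu (S (S p)) (S (S (S p / 2)))).
  2: pose proof (Nat.div_mod_eq (S (S p)) 2); pose proof (Nat.mod_upper_bound (S (S p)) 2);
     pose proof (Nat.div_mod_eq (S p) 2); pose proof (Nat.mod_upper_bound (S p) 2); lia.
  rewrite !(sumR_first (S (S p / 2))), lommel_coef_SS_0.
  rewrite (sumR_ext _ (fun i => lommel_coef mu (S (S p)) (S i) * _) (fun i =>
    x * (lommel_coef mu p i * x ^ i)
    + (- (mu - INR p - 1)) * (lommel_coef mu (S p) (S i) * x ^ S i))).
  2:{ intros i _; rewrite lommel_coef_SS_S; simpl pow; ring. }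
  rewrite sumR_plus, !sumR_scal; ring.
Qed.

(** Both coefficients follow the recurrence of [lommel_SS], with nu replaced by nu - 1 and p lagging
    by one in front of u_1; hence strong induction reaching two steps back. *)
Lemma rec_seq_down nu x u p : rec_seq nu x u ->
  x ^ S p * u (- Z.of_nat (S p))%Z = lommel nu (S p) x * u 0%Z + lommel (nu - 1) p x * u 1%Z.
Proof.
  intros Hu.
  assert (Hs : forall p, x * u (- Z.of_nat (S p))%Z
    = u (1 - Z.of_nat p)%Z - (nu - INR p) * u (- Z.of_nat p)%Z).
  { intros q; rewrite (rec_seq_x nu x u _ Hu), opp_IZR, <- INR_IZR_INZ, S_INR.
    replace (- Z.of_nat (S q) + 2)%Z with (1 - Z.of_nat q)%Z by lia.
    replace (- Z.of_nat (S q) + 1)%Z with (- Z.of_nat q)%Z by lia; ring. }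
  induction p as [p IH] using lt_wf_ind.
  transitivity (x ^ p * (x * u (- Z.of_nat (S p))%Z)); [simpl pow; ring|]; rewrite Hs.
  destruct p as [|p].
  - rewrite lommel_0, lommel_1; simpl; ring.
  - transitivity (x * (x ^ p * u (- Z.of_nat p)%Z)
       - (nu - INR (S p)) * (x ^ S p * u (- Z.of_nat (S p))%Z)).
    { replace (1 - Z.of_nat (S p))%Z with (- Z.of_nat p)%Z by lia; simpl pow; ring. }
    rewrite IH by lia; rewrite (lommel_SS nu p), S_INR.
    destruct p as [|p].
    + rewrite !lommel_0, !lommel_1; simpl; ring.
    + rewrite IH by lia; rewrite (lommel_SS (nu - 1) p), !S_INR; ring.
Qed.

(* The recurrence's solution with [u 0 = 1], [u 1 = 0]: it reads off the
   coefficient of [rho_nu] without any independence argument. *)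
Fixpoint upper_seq (nu x : R) (q : nat) : R :=
  match q with
  | O => 1
  | S q' => match q' with
            | O => 0
            | S q'' => (nu + INR q') * upper_seq nu x q' + x * upper_seq nu x q''
            end
  end.

(** At negative indices u_1 = 0 leaves only the first term of [rec_seq_down], divided by the power
    of x. [leibniz] reads only indices z <= 0; the upper half makes the recurrence hold on all
    integers. *)
Definition unit_seq (nu x : R) (z : Z) : R :=
  if Z.leb 0 z then upper_seq nu x (Z.to_nat z)
  else lommel nu (Z.to_nat (- z)) x / x ^ Z.to_nat (- z).

Lemma unit_seq_nonneg nu x q : unit_seq nu x (Z.of_nat q) = upper_seq nu x q.
Proof.
  unfold unit_seq; rewrite (proj2 (Z.leb_le _ _)) by lia; now rewrite Nat2Z.id.
Qed.

Lemma unit_seq_nonpos nu x q : unit_seq nu x (- Z.of_nat q) = lommel nu q x / x ^ q.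
Proof.
  destruct q as [|q].
  - rewrite lommel_0; unfold unit_seq; simpl; field.
  - unfold unit_seq; rewrite (proj2 (Z.leb_gt _ _)) by lia.
    now rewrite Z.opp_involutive, Nat2Z.id.
Qed.

Lemma unit_seq_rec nu x : x <> 0 -> rec_seq nu x (unit_seq nu x).
Proof.
  intros Hx z; destruct (Z.lt_trichotomy z 0) as [Hz|[->|Hz]].
  - replace z with (- Z.of_nat (S (Z.to_nat (- z - 1))))%Z by lia.
    generalize (Z.to_nat (- z - 1)); intros p.
    replace (- Z.of_nat (S p) + 1)%Z with (- Z.of_nat p)%Z by lia.
    replace (- Z.of_nat (S p) - 1)%Z with (- Z.of_nat (S (S p)))%Z by lia.
    rewrite !unit_seq_nonpos, lommel_SS, opp_IZR, <- INR_IZR_INZ, S_INR; simpl pow.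
    field; split; auto using pow_nonzero.
  (* The junction of the two halves: 0 = nu * 1 + x * (- nu / x). *)
  - change (0 + 1)%Z with (Z.of_nat 1); change (0 - 1)%Z with (- Z.of_nat 1)%Z.
    rewrite unit_seq_nonneg, unit_seq_nonpos, lommel_1.
    change 0%Z with (Z.of_nat 0) at 2; rewrite unit_seq_nonneg; simpl; field; assumption.
  - replace z with (Z.of_nat (S (Z.to_nat (z - 1)))) by lia.
    generalize (Z.to_nat (z - 1)); intros p.
    replace (Z.of_nat (S p) + 1)%Z with (Z.of_nat (S (S p))) by lia.
    replace (Z.of_nat (S p) - 1)%Z with (Z.of_nat p) by lia.
    rewrite !unit_seq_nonneg, <- INR_IZR_INZ; reflexivity.
Qed.

Lemma leibniz_unit_seq nu al k x : x <> 0 ->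
  leibniz al k x (unit_seq nu x) = sumR (S k) (fun p => lag al k p * lommel nu p x).
Proof.
  intros Hx; apply sumR_ext; intros p _; rewrite unit_seq_nonpos; field.
  now apply pow_nonzero.
Qed.

(** * The hypergeometric form of the polynomials A *)

Lemma bin_poch k c s :
  bin k (c + s) * poch (INR c + 1) s = bin k c * ((-1) ^ s * poch (- (INR k - INR c)) s).
Proof.
  induction s as [|s IH]; [rewrite Nat.add_0_r; simpl; ring|].
  rewrite Nat.add_succ_r, !poch_last.
  pose proof (bin_absorb k (c + s)) as E; rewrite S_INR, plus_INR in E.
  transitivity (((INR c + INR s + 1) * bin k (S (c + s))) * poch (INR c + 1) s); [ring|].
  rewrite E.
  transitivity ((INR k - (INR c + INR s)) * (bin k (c + s) * poch (INR c + 1) s)); [ring|].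
  rewrite IH; simpl pow; ring.
Qed.

Lemma poch_reflect c s : poch (c - INR s + 1) s = (-1) ^ s * poch (- c) s.
Proof.
  induction s as [|s IH]; [simpl; ring|].
  rewrite poch_first, poch_last, S_INR.
  replace (c - (INR s + 1) + 1 + 1) with (c - INR s + 1) by ring.
  rewrite IH; simpl pow; ring.
Qed.

Lemma poch_fact s i : poch (INR s + 1) i * INR (fact s) = INR (fact (s + i)).
Proof.
  induction i as [|i IH]; [rewrite Nat.add_0_r; simpl; ring|].
  rewrite Nat.add_succ_r, fact_simpl, mult_INR, <- IH, poch_last, S_INR, plus_INR; ring.
Qed.

(** With p = 2i + s the factors of the hypergeometric term arise separately: C(k,2i+s) yields
    (-(k-2i))_s / (2i+1)_s, the descent coefficient yields (i-nu)_s, the quotient (s+1)_i / i!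
    equals (i+1)_s / s!, and splitting (al+1)_k yields 1 / (2i+1+al)_s. The signs (-1)^p and (-1)^s
    each occur twice and cancel. *)
Lemma lag_lommel_coef nu al k i s : -1 < al -> (2 * i + s <= k)%nat ->
  lag al k (2 * i + s) * lommel_coef nu (2 * i + s) i
  = poch (al + 1) k * (binom k (2 * i) / poch (al + 1) (2 * i)) *
    (poch (- INR (k - 2 * i)) s * poch (INR i - nu) s * poch (INR i + 1) s
     / (poch (2 * INR i + 1 + al) s * poch (2 * INR i + 1) s * INR (fact s))).
Proof.
  intros Hal Hk; unfold lag, lommel_coef.
  rewrite (proj2 (Nat.leb_le _ _)) by lia.
  rewrite binom_bin by lia.
  replace (2 * i + s - 2 * i)%nat with s by lia.
  pose proof (pos_INR i) as Hi.
  assert (E2 : INR (2 * i) = 2 * INR i) by (rewrite mult_INR; simpl; ring).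
  pose proof (bin_poch k (2 * i) s) as E; rewrite E2 in E.
  replace (nu + INR i - INR (2 * i + s) + 1) with (nu - INR i - INR s + 1)
    by (rewrite plus_INR, E2; ring).
  rewrite poch_reflect; replace (- (nu - INR i)) with (INR i - nu) by ring.
  rewrite minus_INR, E2 by lia.
  pose proof (poch_fact s i) as F1; pose proof (poch_fact i s) as F2.
  rewrite (Nat.add_comm i s), <- F1 in F2.
  replace k with (2 * i + s + (k - (2 * i + s)))%nat at 3 by lia.
  rewrite !poch_add, plus_INR, E2.
  replace (al + 1 + 2 * INR i) with (2 * INR i + 1 + al) by ring.
  replace (al + 1 + (2 * INR i + INR s)) with (al + (2 * INR i + INR s) + 1) by ring.
  pose proof (INR_fact_lt_0 i) as P1; pose proof (INR_fact_lt_0 s) as P2.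
  pose proof (poch_pos (al + 1) (2 * i) ltac:(lra)) as P3.
  pose proof (poch_pos (2 * INR i + 1 + al) s ltac:(lra)) as P4.
  pose proof (poch_pos (2 * INR i + 1) s ltac:(lra)) as P5.
  set (p4 := poch (2 * INR i + 1 + al) s) in *; set (p5 := poch (2 * INR i + 1) s) in *.
  set (p3 := poch (al + 1) (2 * i)) in *.
  set (g := poch (- (INR k - 2 * INR i)) s) in *.
  assert (Eb : bin k (2 * i + s) = bin k (2 * i) * ((-1) ^ s * g) / p5)
    by (rewrite <- E; field; lra).
  assert (Ef : poch (INR s + 1) i = poch (INR i + 1) s * INR (fact i) / INR (fact s))
    by (rewrite F2; field; lra).
  rewrite Eb, Ef.
  assert (Es : (-1) ^ (2 * i + s) * (-1) ^ (2 * i + s) = 1)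
    by (rewrite <- Rpow_mult_distr; replace (-1 * -1) with 1 by ring; apply pow1).
  assert (Es' : (-1) ^ s * (-1) ^ s = 1)
    by (rewrite <- Rpow_mult_distr; replace (-1 * -1) with 1 by ring; apply pow1).
  set (e := (-1) ^ (2 * i + s)) in *; set (e' := (-1) ^ s) in *.
  transitivity ((e * e) * (e' * e') * (bin k (2 * i) * g / p5
    * poch (al + (2 * INR i + INR s) + 1) (k - (2 * i + s))
    * poch (INR i - nu) s * poch (INR i + 1) s / INR (fact s))).
  - field; lra.
  - rewrite Es, Es'; field; lra.
Qed.

(** The power of x depends on i alone, so after interchanging the sums the inner sum over p = 2i + s
    is a terminating 3F2 at 1. The two parities of k give the two families A. *)
Lemma sum_lag_lommel nu al k x : -1 < al ->
  sumR (S k) (fun p => lag al k p * lommel nu p x)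
  = poch (al + 1) k * sumR (S (k / 2)) (fun i =>
      binom k (2 * i) * x ^ i / poch (al + 1) (2 * i)
      * F32_term (k - 2 * i) (INR i - nu) (INR i + 1) (2 * INR i + 1 + al) (2 * INR i + 1)).
Proof.
  intros Hal.
  rewrite (sumR_ext _ _ (fun p => sumR (S (k / 2)) (fun i => lag al k p * lommel_coef nu p i * x ^ i))).
  2:{ intros p Hp; rewrite (lommel_extend nu p (S (k / 2))).
      - rewrite <- sumR_scal; apply sumR_ext; intros; ring.
      - pose proof (Nat.Div0.div_le_mono p k 2 ltac:(lia)); lia. }
  rewrite sumR_swap, <- sumR_scal; apply sumR_ext; intros i Hi.
  assert (Hik : (2 * i <= k)%nat)
    by (pose proof (Nat.div_mod_eq k 2); pose proof (Nat.mod_upper_bound k 2); lia).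
  replace (S k) with (2 * i + S (k - 2 * i))%nat by lia.
  rewrite sumR_app, sumR_zero by (intros p Hp; rewrite lommel_coef_gt by lia; ring).
  rewrite Rplus_0_l; unfold F32_term.
  rewrite <- sumR_scal, <- sumR_scal; apply sumR_ext; intros s Hs.
  rewrite lag_lommel_coef by (assumption || lia).
  unfold Rdiv; ring.
Qed.

Lemma A_jjm1_lommel nu al j x : -1 < al ->
  A_jjm1 nu al j x = sumR (S (2 * j)) (fun p => lag al (2 * j) p * lommel nu p x).
Proof.
  intros Hal; rewrite sum_lag_lommel by assumption; unfold A_jjm1; f_equal.
  replace (2 * j / 2)%nat with j by (rewrite Nat.mul_comm, Nat.div_mul; lia).
  apply sumR_ext; intros i Hi; now replace (2 * j - 2 * i)%nat with (2 * (j - i))%nat by lia.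
Qed.

Lemma A_jj_lommel nu al j x : -1 < al ->
  A_jj nu al j x = sumR (S (2 * j + 1)) (fun p => lag al (2 * j + 1) p * lommel nu p x).
Proof.
  intros Hal; rewrite sum_lag_lommel by assumption; unfold A_jj; f_equal.
  replace ((2 * j + 1) / 2)%nat with j
    by (rewrite Nat.add_comm, Nat.mul_comm, Nat.div_add by lia; reflexivity).
  apply sumR_ext; intros i Hi; now replace (2 * j + 1 - 2 * i)%nat with (2 * (j - i) + 1)%nat by lia.
Qed.

(** * The bracket of the Rodrigues formula *)

Lemma lommel_term nu p i x : (i < S (p / 2))%nat ->
  poch (nu + INR i - INR p + 1) (p - 2 * i) * poch (INR (p - 2 * i) + 1) i * x ^ i / INR (fact i)
  = (-1) ^ p * (lommel_coef nu p i * x ^ i).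
Proof.
  intros H; unfold lommel_coef; rewrite (proj2 (Nat.leb_le _ _)).
  2: pose proof (Nat.div_mod_eq p 2); lia.
  assert (Es : (-1) ^ p * (-1) ^ p = 1)
    by (rewrite <- Rpow_mult_distr; replace (-1 * -1) with 1 by ring; apply pow1).
  unfold Rdiv; ring [Es].
Qed.

(* Leibniz' rule for [x^(s+nu+j) * (x^(-nu) rho_nu)] instead of [x^(s+j) * rho_nu]. *)
Lemma leibniz_split nu s j x u :
  leibniz s j x u = sumR (S j) (fun k => sumR (S k) (fun m =>
    (-1) ^ k * poch (s + nu + INR k + 1) (j - k) * poch nu (k - m) * bin j k * bin k m
    * (x ^ m * u (- Z.of_nat m)%Z))).
Proof.
  rewrite (sumR_ext _ _ (fun k => sumR (S j) (fun m =>
    (-1) ^ k * poch (s + nu + INR k + 1) (j - k) * poch nu (k - m) * bin j k * bin k m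
    * (x ^ m * u (- Z.of_nat m)%Z)))).
  2:{ intros k Hk; symmetry; apply sumR_extend; [lia|].
      intros m Hm; rewrite (bin_gt k m) by lia; ring. }
  rewrite sumR_swap; apply sumR_ext; intros m Hm; unfold lag.
  replace (s + INR m + 1) with (s + nu + INR m + 1 - nu) by ring.
  transitivity ((-1) ^ m * (bin j m * poch (s + nu + INR m + 1 - nu) (j - m)) * (x ^ m * u (- Z.of_nat m)%Z));
    [ring|].
  rewrite <- vandermonde_trinomial by lia; rewrite Rmult_assoc, (Rmult_comm (sumR _ _)).
  rewrite <- Rmult_assoc, <- sumR_scal; apply sumR_ext; intros k Hk.
  destruct (Nat.le_gt_cases m k) as [H|H].
  - replace (s + nu + INR m + 1 + INR (k - m)) with (s + nu + INR k + 1)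
      by (rewrite minus_INR by lia; ring).
    assert (Es : (-1) ^ m * (-1) ^ m = 1)
      by (rewrite <- Rpow_mult_distr; replace (-1 * -1) with 1 by ring; apply pow1).
    rewrite pow_add; ring [Es].
  - rewrite (bin_gt k m) by lia; ring.
Qed.

(** In [leibniz_split] the term x^p u_{-p} is replaced by its descent to u_0 and u_1. For p = 0
    there is no u_1 part, so the second sum runs over p = m + 1; this explains its shorter range and
    the entries k - m - 1 and m + 1. *)
Lemma S1_S2_leibniz a nu al n x u : rec_seq nu x u ->
  u 0%Z * S1 a nu al n x + u 1%Z * S2 a nu al n x
  = sumR (S n) (fun j => cnk a nu al n (j + n) / INR (fact (j + n)) * leibniz (INR n + al) j x u).
Proof.
  intros Hu; unfold S1, S2; rewrite <- !sumR_scal, <- sumR_plus; apply sumR_ext; intros j Hj.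
  rewrite (leibniz_split nu), <- !sumR_scal, <- sumR_plus; apply sumR_ext; intros k Hk.
  set (c := cnk a nu al n (j + n) / INR (fact (j + n))).
  set (d := fun e => c * (-1) ^ k * poch (INR n + al + nu + INR k + 1) (j - k) * bin j k * e).
  replace (INR n + nu + al + INR k + 1) with (INR n + al + nu + INR k + 1) by ring.
  assert (Es : forall p, (-1) ^ p * (-1) ^ p = 1)
    by (intros p; rewrite <- Rpow_mult_distr; replace (-1 * -1) with 1 by ring; apply pow1).
  rewrite (sumR_ext (S k) (fun m => sumR _ _)
    (fun m => d (poch nu (k - m) * bin k m) * lommel nu m x)).
  2:{ intros m Hm; unfold lommel; rewrite <- sumR_scal; apply sumR_ext; intros i Hi.
      rewrite !binom_bin by lia; unfold d, c.
      pose proof (lommel_term nu m i x Hi) as E.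
      transitivity ((-1) ^ k * (-1) ^ m / INR (fact (j + n)) * cnk a nu al n (j + n)
        * poch (INR n + al + nu + INR k + 1) (j - k) * poch nu (k - m) * bin j k * bin k m
        * (poch (nu + INR i - INR m + 1) (m - 2 * i) * poch (INR (m - 2 * i) + 1) i * x ^ i / INR (fact i))).
      { rewrite pow_add; unfold Rdiv; ring. }
      rewrite E; unfold Rdiv; ring [(Es m)]. }
  rewrite (sumR_ext k (fun m => sumR _ _)
    (fun m => d (poch nu (k - S m) * bin k (S m)) * lommel (nu - 1) m x)).
  2:{ intros m Hm; unfold lommel; rewrite <- sumR_scal; apply sumR_ext; intros i Hi.
      rewrite !binom_bin by lia; unfold d, c.
      pose proof (lommel_term (nu - 1) m i x Hi) as E.
      replace (nu - 1 + INR i - INR m + 1) with (nu + INR i - INR m) in E by ring.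
      replace (k - S m)%nat with (k - m - 1)%nat by lia.
      replace (m + 1)%nat with (S m) by lia.
      transitivity ((-1) ^ k * (-1) ^ m / INR (fact (j + n)) * cnk a nu al n (j + n)
        * poch (INR n + al + nu + INR k + 1) (j - k) * poch nu (k - m - 1) * bin j k * bin k (S m)
        * (poch (nu + INR i - INR m) (m - 2 * i) * poch (INR (m - 2 * i) + 1) i * x ^ i / INR (fact i))).
      { rewrite pow_add; unfold Rdiv; ring. }
      rewrite E; unfold Rdiv; ring [(Es m)]. }
  rewrite !sumR_first, lommel_0, Rmult_plus_distr_l, Rplus_assoc, <- !sumR_scal, <- sumR_plus.
  rewrite Rmult_plus_distr_l, <- sumR_scal; f_equal.
  - unfold d; simpl; ring.
  - apply sumR_ext; intros m Hm.
    rewrite (rec_seq_down nu x u m Hu); unfold d; ring.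
Qed.

(** * Improper integrals and the modified Bessel function *)

(** With z = c y / M, the inequality 1 + ln z <= z bounds M ln y - c y by M ln(M / c). The true
    maximum is smaller by the factor e^{-M}, which is dropped. *)
Lemma Rpower_exp_le M c : 0 < M -> 0 < c -> forall y, 0 < y ->
  Rpower y M * exp (- c * y) <= exp (M * ln (M / c)).
Proof.
  intros HM Hc y Hy; unfold Rpower; rewrite <- exp_plus.
  assert (Hle : M * ln y + - c * y <= M * ln (M / c)).
  { assert (Hz : 0 < c * y / M) by (apply Rdiv_lt_0_compat; nra).
    pose proof (exp_ineq1_le (ln (c * y / M))) as E; rewrite exp_ln in E by assumption.
    replace y with ((c * y / M) * (M / c)) at 1 by (field; lra).
    rewrite ln_mult by (assumption || apply Rdiv_lt_0_compat; lra).
    apply (Rmult_le_compat_l M) in E; [|lra].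
    replace (M * (c * y / M)) with (c * y) in E by (field; lra).
    rewrite Rmult_plus_distr_l in *; lra. }
  destruct Hle as [Hlt | ->]; [left; now apply exp_increasing|right; reflexivity].
Qed.

Lemma exp_le_mono x y : x <= y -> exp x <= exp y.
Proof. intros [H| ->]; [left; now apply exp_increasing|right; reflexivity]. Qed.

Lemma filterlim_dominated (F : (R -> Prop) -> Prop) {FF : Filter F} (f g : R -> R) :
  F (fun x => Rabs (f x) <= g x) -> filterlim g F (locally 0) -> filterlim f F (locally 0).
Proof.
  intros Hfg Hg; apply filterlim_locally; intros eps.
  rewrite filterlim_locally in Hg; specialize (Hg eps).
  generalize (filter_and _ _ Hfg Hg); apply filter_imp; intros x [H1 H2].
  change (Rabs (f x - 0) < eps); change (Rabs (g x - 0) < eps) in H2.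
  rewrite Rminus_0_r in *; apply Rle_lt_trans with (1 := H1).
  apply Rle_lt_trans with (2 := H2), Rle_abs.
Qed.

Lemma filterlim_scal_0 (F : (R -> Prop) -> Prop) {FF : Filter F} (c : R) (f : R -> R) :
  filterlim f F (locally 0) -> filterlim (fun x => c * f x) F (locally 0).
Proof.
  intros Hf; replace 0 with (c * 0) by ring.
  exact (filterlim_comp _ _ _ f (fun y => c * y) F (locally 0) _ Hf (filterlim_scal_r c 0)).
Qed.

Lemma filterlim_plus_0 (F : (R -> Prop) -> Prop) {FF : Filter F} (f g : R -> R) :
  filterlim f F (locally 0) -> filterlim g F (locally 0) ->
  filterlim (fun x => f x + g x) F (locally 0).
Proof.
  intros Hf Hg; replace 0 with (0 + 0) by ring.
  exact (filterlim_comp_2 f g Rplus Hf Hg (filterlim_plus 0 0)).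
Qed.

Lemma Rpower_lim_0 c : 0 < c -> filterlim (fun x => Rpower x c) (at_right 0) (locally 0).
Proof.
  intros Hc; apply filterlim_locally; intros eps.
  exists (mkposreal (Rpower eps (/ c)) (exp_pos _)); intros y Hy Hy0.
  change (Rabs (y - 0) < Rpower eps (/ c)) in Hy; change (Rabs (Rpower y c - 0) < eps).
  rewrite Rminus_0_r in *; rewrite Rabs_pos_eq in Hy by lra.
  rewrite Rabs_pos_eq by (left; apply exp_pos).
  replace (pos eps) with (Rpower (Rpower eps (/ c)) c).
  - apply Rlt_Rpower_l; lra.
  - rewrite Rpower_mult, Rinv_l, Rpower_1 by (try lra; apply cond_pos); reflexivity.
Qed.

Lemma inv_lim_infty : filterlim (fun x => / x) (Rbar_locally p_infty) (locally 0).
Proof.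
  apply filterlim_locally; intros eps; exists (/ eps); intros x Hx.
  pose proof (cond_pos eps) as He; pose proof (Rinv_0_lt_compat _ He) as Hi.
  change (Rabs (/ x - 0) < eps); rewrite Rminus_0_r, Rabs_pos_eq.
  - rewrite <- (Rinv_inv eps); apply Rinv_lt_contravar; [apply Rmult_lt_0_compat; lra|assumption].
  - left; apply Rinv_0_lt_compat; lra.
Qed.

Lemma exp_lim_infty d : 0 < d ->
  filterlim (fun t => exp (- d * t)) (Rbar_locally p_infty) (locally 0).
Proof.
  intros Hd; apply filterlim_dominated with (fun t => / d * / t); try apply _.
  - exists 0; intros t Ht; rewrite Rabs_pos_eq by (left; apply exp_pos).
    replace (- d * t) with (- (d * t)) by ring; rewrite exp_Ropp, <- Rinv_mult.
    apply Rinv_le_contravar; [nra|]; pose proof (exp_ineq1_le (d * t)); lra.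
  - apply filterlim_scal_0; [apply _|apply inv_lim_infty].
Qed.

Lemma is_RInt_gen_ext_all (Fa Fb : (R -> Prop) -> Prop) {FFa : Filter Fa} {FFb : Filter Fb}
    (f g : R -> R) (l : R) :
  (forall x, f x = g x) -> is_RInt_gen f Fa Fb l -> is_RInt_gen g Fa Fb l.
Proof.
  intros H; apply is_RInt_gen_ext.
  exists (fun _ => True) (fun _ => True); try apply filter_true; auto.
Qed.

(* [D] is [x > 0] with [Fa = at_right 0], or [x >= 0] with [Fa = at_point 0]. *)
Section HalfLine.
Context (Fa : (R -> Prop) -> Prop) {FFa : Filter Fa} (D : R -> Prop).
Hypothesis HD : forall x0, D x0 -> Fa (fun x => D x /\ x <= x0).
Hypothesis Dup : forall x y, D x -> x <= y -> D y.
Hypothesis Dne : exists x0, D x0.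

Lemma D_RInt (f : R -> R) a b : (forall x, D x -> continuous f x) -> D a -> a <= b -> ex_RInt f a b.
Proof.
  intros Hf Ha Hab; apply (ex_RInt_continuous (V := R_CompleteNormedModule)).
  intros z; rewrite Rmin_left, Rmax_right by assumption; intros Hz.
  apply Hf, (Dup a); tauto.
Qed.

(** The integral of a nonnegative function is the supremum of its integrals over compact intervals,
    finite because the majorant has a primitive of bounded increments. The lower bounds by partial
    integrals later give positivity. *)
Lemma is_RInt_gen_dominated (f g G : R -> R) (B : R) :
  (forall x, D x -> continuous f x) -> (forall x, D x -> continuous g x) ->
  (forall x, D x -> 0 <= f x <= g x) ->
  (forall x, D x -> is_derive G x (g x)) ->
  (forall x y, D x -> D y -> G y - G x <= B) ->
  exists l, is_RInt_gen f Fa (Rbar_locally p_infty) l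
    /\ (forall a b, D a -> a <= b -> RInt f a b <= l) /\ l <= B.
Proof.
  intros Hf Hg Hfg HG HB.
  pose (E := fun r => exists a b, D a /\ a <= b /\ r = RInt f a b).
  assert (HEB : is_upper_bound E B).
  { intros r (a & b & Ha & Hab & ->).
    apply Rle_trans with (2 := HB a b Ha (Dup a b Ha Hab)).
    rewrite <- (is_RInt_unique g a b (G b - G a)).
    - apply RInt_le; try apply D_RInt; auto.
      intros x Hx; apply Hfg, (Dup a); [assumption|lra].
    - apply (is_RInt_derive G g); rewrite Rmin_left, Rmax_right by assumption;
        intros x Hx; [apply HG|apply Hg]; apply (Dup a); tauto. }
  destruct (completeness E) as [l [Hub Hlub]].
  { now exists B. }
  { destruct Dne as [x0 Hx0]; exists (RInt f x0 x0), x0, x0; auto with real. }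
  assert (Hl : forall a b, D a -> a <= b -> RInt f a b <= l).
  { intros a b Ha Hab; apply Hub; now exists a, b. }
  exists l; split; [|split; [assumption|now apply Hlub]].
  intros P [eps HP].
  assert (Hr : exists a b, D a /\ a <= b /\ l - eps < RInt f a b).
  { destruct (Classical_Prop.classic (exists a b, D a /\ a <= b /\ l - eps < RInt f a b)) as [H|H];
      [assumption|exfalso].
    assert (l <= l - eps); [|pose proof (cond_pos eps); lra].
    apply Hlub; intros r (a & b & Ha & Hab & ->).
    apply Rnot_lt_le; intros Hlt; apply H; now exists a, b. }
  destruct Hr as (a0 & b0 & Ha0 & Hab0 & Hr).
  exists (fun a => D a /\ a <= a0) (fun b => b0 < b).
  - now apply HD.
  - now exists b0.
  - intros a b [Ha Haa0] Hb; simpl.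
    assert (Hab : a <= b) by lra.
    exists (RInt f a b); split; [apply (RInt_correct f), D_RInt; auto|].
    apply HP; change (Rabs (RInt f a b - l) < eps).
    assert (RInt f a b <= l) by auto.
    assert (RInt f a0 b0 <= RInt f a b).
    { assert (Hpos : forall c d, D c -> c <= d -> 0 <= RInt f c d).
      { intros c d Hc Hcd; apply RInt_ge_0; [assumption|now apply D_RInt|].
        intros x Hx; apply Hfg, (Dup c); [assumption|lra]. }
      assert (D b0) by (apply (Dup a0); auto).
      rewrite <- (RInt_Chasles f a a0 b), <- (RInt_Chasles f a0 b0 b);
        try (apply D_RInt; auto; lra).
      pose proof (Hpos a a0 Ha Haa0); pose proof (Hpos b0 b ltac:(assumption) ltac:(lra)).
      unfold plus; simpl; lra. }
    rewrite Rabs_left1; lra.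
Qed.

Lemma is_RInt_gen_derive_lim (F f : R -> R) (la lb : R) :
  (forall x, D x -> is_derive F x (f x)) -> (forall x, D x -> continuous f x) ->
  filterlim F Fa (locally la) -> filterlim F (Rbar_locally p_infty) (locally lb) ->
  is_RInt_gen f Fa (Rbar_locally p_infty) (lb - la).
Proof.
  intros HF Hf Hla Hlb P HP.
  assert (Hlim : filterlim (fun ab => F (snd ab) - F (fst ab))
    (filter_prod Fa (Rbar_locally p_infty)) (locally (lb - la))).
  { refine (filterlim_comp_2 (fun ab => F (snd ab)) (fun ab => F (fst ab)) Rminus _ _ _).
    - refine (filterlim_comp _ _ _ snd F _ _ _ filterlim_snd Hlb).
    - refine (filterlim_comp _ _ _ fst F _ _ _ filterlim_fst Hla).
    - apply (filterlim_comp_2 (G := locally lb) (H := locally (- la)) fst (fun z => - snd z) Rplus).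
      + apply filterlim_fst.
      + refine (filterlim_comp _ _ _ snd Ropp _ _ _ filterlim_snd _).
        exact (filterlim_opp (V := R_NormedModule) la).
      + exact (filterlim_plus (V := R_NormedModule) lb (- la)). }
  specialize (Hlim P HP).
  destruct Dne as [x0 Hx0].
  assert (Hev : filter_prod Fa (Rbar_locally p_infty) (fun ab => D (fst ab) /\ fst ab <= snd ab)).
  { exists (fun a => D a /\ a <= x0) (fun b => x0 < b); [now apply HD|now exists x0|].
    intros a b [Ha Hax] Hb; simpl; split; [assumption|lra]. }
  unfold filtermap in Hlim; unfold filtermapi; generalize (filter_and _ _ Hlim Hev); apply filter_imp.
  intros [a b] [HP' [Ha Hab]]; simpl in *.
  exists (F b - F a); split; [|exact HP'].
  apply (is_RInt_derive F f); rewrite Rmin_left, Rmax_right by assumption;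
    intros x Hx; [apply HF|apply Hf]; apply (Dup a); tauto.
Qed.
End HalfLine.

Lemma at_right_0_down x0 : 0 < x0 -> at_right 0 (fun x => 0 < x /\ x <= x0).
Proof.
  intros H; exists (mkposreal x0 H); intros y Hy Hy0.
  change (Rabs (y - 0) < x0) in Hy; rewrite Rminus_0_r, Rabs_pos_eq in Hy; lra.
Qed.

Lemma at_point_0_down x0 : 0 <= x0 -> at_point 0 (fun x => 0 <= x /\ x <= x0).
Proof. intros H; unfold at_point; lra. Qed.

Lemma half_line_up c x y : c < x -> x <= y -> c < y.
Proof. lra. Qed.

Definition bessel_integrand (mu y t : R) : R := exp (- y * cosh t) * cosh (mu * t).

Lemma cosh_ge_half_exp t : exp t / 2 <= cosh t.
Proof. unfold cosh; pose proof (exp_pos (- t)); lra. Qed.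

Lemma cosh_ge_1 t : 1 <= cosh t.
Proof.
  unfold cosh; pose proof (exp_ineq1_le t); pose proof (exp_ineq1_le (- t)); lra.
Qed.

Lemma cosh_le_exp mu t : 0 <= t -> cosh (mu * t) <= exp (Rabs mu * t).
Proof.
  intros Ht; unfold cosh; pose proof (Rle_abs mu); pose proof (Rle_abs (- mu)).
  rewrite Rabs_Ropp in *.
  pose proof (exp_le_mono (mu * t) (Rabs mu * t) ltac:(nra)).
  pose proof (exp_le_mono (- (mu * t)) (Rabs mu * t) ltac:(nra)); lra.
Qed.

Lemma bessel_integrand_pos mu y t : 0 < bessel_integrand mu y t.
Proof.
  apply Rmult_lt_0_compat; [apply exp_pos|pose proof (cosh_ge_1 (mu * t)); lra].
Qed.

(* One estimate gives convergence of the integral, the growth of [BesselK mu] at [0]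
   ([M] close to [Rabs mu]) and its decay at infinity ([M] large). *)
Lemma bessel_integrand_le mu M : Rabs mu < M -> exists C, 0 < C /\ forall y t, 0 < y -> 0 <= t ->
  bessel_integrand mu y t <= C * Rpower y (- M) * exp (- (M - Rabs mu) * t).
Proof.
  intros HM; exists (exp (M * ln (M / (1 / 2)))); split; [apply exp_pos|]; intros y t Hy Ht.
  pose proof (Rabs_pos mu) as Hmu.
  assert (Hyt : 0 < y * exp t) by (apply Rmult_lt_0_compat; [assumption|apply exp_pos]).
  (* Applied to the variable y e^t, since cosh t >= e^t / 2. *)
  pose proof (Rpower_exp_le M (1 / 2) ltac:(lra) ltac:(lra) _ Hyt) as E.
  set (C := exp (M * ln (M / (1 / 2)))) in *.
  assert (E1 : exp (- y * cosh t) <= C * Rpower y (- M) * exp (- M * t)).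
  { apply Rle_trans with (exp (- (1 / 2) * (y * exp t))).
    - apply exp_le_mono; pose proof (cosh_ge_half_exp t); nra.
    - rewrite <- Rpower_mult_distr in E by (assumption || apply exp_pos).
      unfold Rpower at 2 in E; rewrite ln_exp in E.
      assert (P1 : Rpower y M * Rpower y (- M) = 1)
        by (rewrite <- Rpower_plus, Rplus_opp_r; apply Rpower_O; assumption).
      assert (P2 : exp (M * t) * exp (- M * t) = 1)
        by (rewrite <- exp_plus; replace (M * t + - M * t) with 0 by ring; apply exp_0).
      assert (P3 : 0 < Rpower y (- M) * exp (- M * t))
        by (apply Rmult_lt_0_compat; apply exp_pos).
      apply (Rmult_le_compat_r (Rpower y (- M) * exp (- M * t))) in E; [|lra].
      set (e := exp (- (1 / 2) * (y * exp t))) in *.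
      replace e with (e * (Rpower y M * Rpower y (- M)) * (exp (M * t) * exp (- M * t)))
        by (rewrite P1, P2; ring).
      lra. }
  replace (- (M - Rabs mu) * t) with (- M * t + Rabs mu * t) by ring.
  rewrite exp_plus, <- Rmult_assoc; unfold bessel_integrand.
  apply Rmult_le_compat; try assumption.
  - left; apply exp_pos.
  - pose proof (cosh_ge_1 (mu * t)); lra.
  - now apply cosh_le_exp.
Qed.

Lemma bessel_integrand_continuous mu y t : continuous (bessel_integrand mu y) t.
Proof.
  apply (ex_derive_continuous (bessel_integrand mu y)); unfold bessel_integrand, cosh.
  auto_derive; auto.
Qed.

(** Integrating the majorant C y^{-M} e^{-dt} with d = M - |mu| gives C / d. The constant does not
    depend on y, so one bound describes both ends of the half-line. *)
Lemma BesselK_spec mu M : Rabs mu < M -> exists C, forall y, 0 < y ->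
  is_RInt_gen (bessel_integrand mu y) (at_point 0) (Rbar_locally p_infty) (BesselK mu y)
  /\ 0 < BesselK mu y <= C * Rpower y (- M).
Proof.
  intros HM; destruct (bessel_integrand_le mu M HM) as [C [HC Hle]].
  set (d := M - Rabs mu) in *; assert (Hd : 0 < d) by (unfold d; lra).
  exists (C / d); intros y Hy.
  assert (HCy : 0 < C * Rpower y (- M)) by (apply Rmult_lt_0_compat; [assumption|apply exp_pos]).
  destruct (is_RInt_gen_dominated (at_point 0) (Rle 0) at_point_0_down (fun x y => Rle_trans 0 x y)
    (ex_intro _ 0 (Rle_refl 0)) (bessel_integrand mu y)
    (fun t => C * Rpower y (- M) * exp (- d * t))
    (fun t => - (C * Rpower y (- M) / d) * exp (- d * t)) (C / d * Rpower y (- M)))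
    as (l & Hl & Hlow & Hup).
  - intros; apply bessel_integrand_continuous.
  - intros x _; apply (ex_derive_continuous (fun t => C * Rpower y (- M) * exp (- d * t))).
    auto_derive; auto.
  - intros t Ht; split; [left; apply bessel_integrand_pos|auto].
  - intros t _; auto_derive; auto; field; lra.
  - intros s t Hs Ht.
    pose proof (exp_le_mono (- d * s) 0 ltac:(nra)) as E; rewrite exp_0 in E.
    pose proof (exp_pos (- d * t)).
    assert (0 < C * Rpower y (- M) / d) by (apply Rdiv_lt_0_compat; assumption).
    replace (C / d * Rpower y (- M)) with (C * Rpower y (- M) / d) by (field; lra); nra.
  - assert (El : BesselK mu y = l) by (apply is_RInt_gen_unique; exact Hl).
    rewrite El; split; [exact Hl|split; [|exact Hup]].
    apply Rlt_le_trans with (2 := Hlow 0 1 (Rle_refl 0) Rle_0_1).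
    apply RInt_gt_0; [lra| |]; intros; [apply bessel_integrand_pos|apply bessel_integrand_continuous].
Qed.

Lemma BesselK_int mu y : 0 < y ->
  is_RInt_gen (bessel_integrand mu y) (at_point 0) (Rbar_locally p_infty) (BesselK mu y).
Proof.
  intros Hy; destruct (BesselK_spec mu (Rabs mu + 1) ltac:(lra)) as [C HC]; now apply HC.
Qed.

Lemma BesselK_pos mu y : 0 < y -> 0 < BesselK mu y.
Proof.
  intros Hy; destruct (BesselK_spec mu (Rabs mu + 1) ltac:(lra)) as [C HC]; now apply HC.
Qed.

Lemma sinh_abs_le x : Rabs (sinh x) <= cosh x.
Proof.
  unfold sinh, cosh; pose proof (exp_pos x); pose proof (exp_pos (- x)).
  apply Rabs_le; lra.
Qed.

Lemma cosh_cosh_plus t s : cosh t * cosh s = (cosh (s + t) + cosh (s - t)) / 2.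
Proof.
  unfold cosh; rewrite !Ropp_minus_distr, Ropp_plus_distr; unfold Rminus; rewrite !exp_plus; field.
Qed.

Lemma sinh_sinh_minus t s : sinh t * sinh s = (cosh (s + t) - cosh (s - t)) / 2.
Proof.
  unfold sinh, cosh; rewrite !Ropp_minus_distr, Ropp_plus_distr; unfold Rminus; rewrite !exp_plus; field.
Qed.

(** Integrate the t-derivative of e^{-y cosh t} sinh(mu t): the boundary values vanish, and sinh t
    sinh(mu t) splits into cosh((mu+1)t) and cosh((mu-1)t). *)
Lemma BesselK_rec mu y : 0 < y ->
  2 * mu * BesselK mu y = y * (BesselK (mu + 1) y - BesselK (mu - 1) y).
Proof.
  intros Hy.
  pose (f := fun t => mu * bessel_integrand mu y t
    + - (y / 2) * (bessel_integrand (mu + 1) y t - bessel_integrand (mu - 1) y t)).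
  assert (H1 : is_RInt_gen f (at_point 0) (Rbar_locally p_infty)
    (mu * BesselK mu y + - (y / 2) * (BesselK (mu + 1) y - BesselK (mu - 1) y))).
  { apply (is_RInt_gen_plus (fun t => mu * bessel_integrand mu y t)).
    - apply (is_RInt_gen_scal (bessel_integrand mu y) mu), BesselK_int; assumption.
    - apply (is_RInt_gen_scal
        (fun t => bessel_integrand (mu + 1) y t - bessel_integrand (mu - 1) y t) (- (y / 2))).
      apply (is_RInt_gen_minus (bessel_integrand (mu + 1) y)); apply BesselK_int; assumption. }
  assert (H2 : is_RInt_gen f (at_point 0) (Rbar_locally p_infty) (0 - 0)).
  { apply (is_RInt_gen_derive_lim (at_point 0) (Rle 0) at_point_0_down (fun x y => Rle_trans 0 x y)
      (ex_intro _ 0 (Rle_refl 0)) (fun t => exp (- y * cosh t) * sinh (mu * t))).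
    - intros t _.
      replace (f t) with (exp (- y * cosh t) * (mu * cosh (mu * t)) + - y * sinh t * exp (- y * cosh t) * sinh (mu * t)).
      + unfold sinh, cosh; auto_derive; auto.
        unfold Rdiv; field.
      + unfold f, bessel_integrand.
        replace ((mu + 1) * t) with (mu * t + t) by ring.
        replace ((mu - 1) * t) with (mu * t - t) by ring.
        transitivity (mu * (exp (- y * cosh t) * cosh (mu * t)) - y * exp (- y * cosh t) * (sinh t * sinh (mu * t)));
          [ring|rewrite sinh_sinh_minus; field].
    - intros t _; apply (ex_derive_continuous f); unfold f, bessel_integrand, cosh; auto_derive; auto.
    - intros P HP; unfold filtermap, at_point.
      rewrite Rmult_0_r, sinh_0, Rmult_0_r; now apply locally_singleton.
    - destruct (bessel_integrand_le mu (Rabs mu + 1) ltac:(lra)) as [C [HC Hle]].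
      apply filterlim_dominated with (fun t => C * Rpower y (- (Rabs mu + 1)) * exp (- (1) * t)); try apply _.
      + exists 0; intros t Ht; rewrite Rabs_mult, Rabs_pos_eq by (left; apply exp_pos).
        specialize (Hle y t Hy ltac:(lra)).
        replace (Rabs mu + 1 - Rabs mu) with 1 in Hle by ring.
        apply Rle_trans with (2 := Hle); apply Rmult_le_compat_l; [left; apply exp_pos|apply sinh_abs_le].
      + apply filterlim_scal_0; [apply _|apply exp_lim_infty; lra]. }
  assert (E : mu * BesselK mu y + - (y / 2) * (BesselK (mu + 1) y - BesselK (mu - 1) y) = 0 - 0).
  { rewrite <- (is_RInt_gen_unique _ _ H1); exact (is_RInt_gen_unique _ _ H2). }
  lra.
Qed.

(** From e^u - 1 <= u e^u one gets e^u - 1 - u <= u (e^u - 1), and |e^u - 1| <= |u| e^{|u|}. *)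
Lemma exp_taylor_2 u : Rabs (exp u - 1 - u) <= u ^ 2 * exp (Rabs u).
Proof.
  pose proof (exp_ineq1_le u) as E1; pose proof (exp_ineq1_le (- u)) as E2.
  assert (E3 : exp u * exp (- u) = 1) by (rewrite <- exp_plus, Rplus_opp_r; apply exp_0).
  pose proof (exp_pos u) as E4.
  assert (E5 : exp u - 1 <= u * exp u) by nra.
  rewrite Rabs_pos_eq by lra.
  destruct (Rle_lt_dec 0 u) as [Hu|Hu].
  - rewrite Rabs_pos_eq by assumption; nra.
  - rewrite Rabs_left by assumption.
    pose proof (exp_ineq1_le (- u)); nra.
Qed.

(** Differentiation under the integral by an explicit remainder: the error of the linear
    approximation of the integrand is at most h^2 cosh^2 t times the integrand at y / 2, and its
    integral is at most h^2 C. *)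
Lemma BesselK_derive mu y : 0 < y ->
  is_derive (BesselK mu) y (- (BesselK (mu + 1) y + BesselK (mu - 1) y) / 2).
Proof.
  intros Hy; apply is_derive_Reals; intros eps Heps.
  set (K1 := - (BesselK (mu + 1) y + BesselK (mu - 1) y) / 2).
  (* This is the integral of cosh^2 t times the integrand of order mu at y / 2: each factor cosh t
     averages the orders mu + 1 and mu - 1. *)
  set (C := (BesselK (mu + 1 + 1) (y / 2) + BesselK (mu + 1 - 1) (y / 2)
    + (BesselK (mu - 1 + 1) (y / 2) + BesselK (mu - 1 - 1) (y / 2))) / 4).
  assert (HC : 0 < C).
  { unfold C; pose proof (BesselK_pos (mu + 1 + 1) (y / 2) ltac:(lra));
    pose proof (BesselK_pos (mu + 1 - 1) (y / 2) ltac:(lra));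
    pose proof (BesselK_pos (mu - 1 + 1) (y / 2) ltac:(lra));
    pose proof (BesselK_pos (mu - 1 - 1) (y / 2) ltac:(lra)); lra. }
  (* The bound y / 2 gives e^{-yc} e^{|h|c} <= e^{-(y/2)c} for c = cosh t; the bound eps / C makes
     the final error |h| C smaller than eps. *)
  assert (Hdel : 0 < Rmin (y / 2) (eps / C)).
  { apply Rmin_pos; [lra|apply Rdiv_lt_0_compat; assumption]. }
  exists (mkposreal _ Hdel); intros h Hh Hhd; simpl in Hhd.
  assert (Hh1 : Rabs h < y / 2) by (apply Rlt_le_trans with (1 := Hhd), Rmin_l).
  assert (Hh2 : Rabs h < eps / C) by (apply Rlt_le_trans with (1 := Hhd), Rmin_r).
  assert (Hyh : 0 < y + h) by (apply Rabs_def2 in Hh1; lra).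
  assert (Hbound : Rabs (BesselK mu (y + h) - BesselK mu y - h * K1) <= h ^ 2 * C).
  { pose (cs := fun t => bessel_integrand (mu + 1) y t + bessel_integrand (mu - 1) y t).
    pose (cc := fun t => bessel_integrand (mu + 1 + 1) (y / 2) t + bessel_integrand (mu + 1 - 1) (y / 2) t
      + (bessel_integrand (mu - 1 + 1) (y / 2) t + bessel_integrand (mu - 1 - 1) (y / 2) t)).
    apply (RInt_gen_norm (V := R_CompleteNormedModule) (Fa := at_point 0) (Fb := Rbar_locally p_infty)
      (fun t => bessel_integrand mu (y + h) t - bessel_integrand mu y t - (- h / 2) * cs t)
      (fun t => h ^ 2 / 4 * cc t)).
    - exists (fun a => a = 0) (fun b => 0 < b); [reflexivity|now exists 0|]; simpl; intros; lra.
    - exists (fun a => a = 0) (fun b => 0 < b); [reflexivity|now exists 0|]; simpl.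
      intros a b -> Hb t Ht.
      change (Rabs (bessel_integrand mu (y + h) t - bessel_integrand mu y t - (- h / 2) * cs t) <= h ^ 2 / 4 * cc t).
      assert (E1 : cs t = 2 * (cosh t * bessel_integrand mu y t)).
      { unfold cs, bessel_integrand.
        replace ((mu + 1) * t) with (mu * t + t) by ring.
        replace ((mu - 1) * t) with (mu * t - t) by ring.
        transitivity (2 * exp (- y * cosh t) * (cosh t * cosh (mu * t)));
          [rewrite cosh_cosh_plus; field|ring]. }
      assert (E2 : cc t = 4 * (cosh t * (cosh t * bessel_integrand mu (y / 2) t))).
      { unfold cc, bessel_integrand.
        replace ((mu + 1 + 1) * t) with ((mu * t + t) + t) by ring.
        replace ((mu + 1 - 1) * t) with ((mu * t + t) - t) by ring.
        replace ((mu - 1 + 1) * t) with ((mu * t - t) + t) by ring.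
        replace ((mu - 1 - 1) * t) with ((mu * t - t) - t) by ring.
        transitivity (4 * exp (- (y / 2) * cosh t) * (cosh t * (cosh t * cosh (mu * t)))); [|ring].
        rewrite (cosh_cosh_plus t (mu * t)).
        replace (cosh t * ((cosh (mu * t + t) + cosh (mu * t - t)) / 2))
          with ((cosh t * cosh (mu * t + t) + cosh t * cosh (mu * t - t)) / 2) by field.
        rewrite !cosh_cosh_plus; field. }
      rewrite E1, E2; unfold bessel_integrand.
      set (c := cosh t); assert (Hc : 1 <= c) by apply cosh_ge_1.
      set (s := cosh (mu * t)); assert (Hs : 1 <= s) by apply cosh_ge_1.
      replace (- (y + h) * c) with (- y * c + - h * c) by ring; rewrite exp_plus.
      replace (exp (- y * c) * exp (- h * c) * s - exp (- y * c) * s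
         - - h / 2 * (2 * (c * (exp (- y * c) * s))))
        with (exp (- y * c) * s * (exp (- h * c) - 1 - (- h * c))) by field.
      rewrite Rabs_mult, Rabs_pos_eq by (pose proof (exp_pos (- y * c)); nra).
      pose proof (exp_taylor_2 (- h * c)) as E3.
      assert (E4 : exp (- y * c) * exp (Rabs (- h * c)) <= exp (- (y / 2) * c)).
      { rewrite <- exp_plus; apply exp_le_mono; rewrite Rabs_mult, Rabs_Ropp, (Rabs_pos_eq c) by lra; nra. }
      apply Rle_trans with (exp (- y * c) * s * ((- h * c) ^ 2 * exp (Rabs (- h * c)))).
      + apply Rmult_le_compat_l; [pose proof (exp_pos (- y * c)); nra|assumption].
      + replace (exp (- y * c) * s * ((- h * c) ^ 2 * exp (Rabs (- h * c))))
          with (s * (h * c) ^ 2 * (exp (- y * c) * exp (Rabs (- h * c)))) by ring.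
        replace (h ^ 2 / 4 * (4 * (c * (c * (exp (- (y / 2) * c) * s)))))
          with (s * (h * c) ^ 2 * exp (- (y / 2) * c)) by field.
        apply Rmult_le_compat_l; [|assumption].
        pose proof (pow2_ge_0 (h * c)); nra.
    - replace (h * K1) with (- h / 2 * (BesselK (mu + 1) y + BesselK (mu - 1) y)) by (unfold K1; field).
      apply (is_RInt_gen_minus (fun t => bessel_integrand mu (y + h) t - bessel_integrand mu y t)).
      + apply (is_RInt_gen_minus (bessel_integrand mu (y + h))); apply BesselK_int; assumption.
      + apply (is_RInt_gen_scal cs), (is_RInt_gen_plus (bessel_integrand (mu + 1) y)); apply BesselK_int; assumption.
    - replace (h ^ 2 * C) with (h ^ 2 / 4 * (4 * C)) by field.
      apply (is_RInt_gen_scal cc (h ^ 2 / 4)).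
      replace (4 * C) with (BesselK (mu + 1 + 1) (y / 2) + BesselK (mu + 1 - 1) (y / 2)
        + (BesselK (mu - 1 + 1) (y / 2) + BesselK (mu - 1 - 1) (y / 2))) by (unfold C; field).
      apply (is_RInt_gen_plus (fun t => bessel_integrand (mu + 1 + 1) (y / 2) t + bessel_integrand (mu + 1 - 1) (y / 2) t));
      [apply (is_RInt_gen_plus (bessel_integrand (mu + 1 + 1) (y / 2)))
      |apply (is_RInt_gen_plus (bessel_integrand (mu - 1 + 1) (y / 2)))]; apply BesselK_int; lra. }
  replace ((BesselK mu (y + h) - BesselK mu y) / h - K1)
    with ((BesselK mu (y + h) - BesselK mu y - h * K1) / h) by (field; assumption).
  unfold Rdiv; rewrite Rabs_mult, Rabs_inv.
  assert (Hh0 : 0 < Rabs h) by now apply Rabs_pos_lt.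
  apply Rle_lt_trans with (h ^ 2 * C * / Rabs h).
  - apply Rmult_le_compat_r; [left; now apply Rinv_0_lt_compat|assumption].
  - rewrite <- (pow2_abs h).
    replace (Rabs h ^ 2 * C * / Rabs h) with (Rabs h * C) by (field; lra).
    apply (Rmult_lt_compat_r C) in Hh2; [|assumption].
    replace (eps / C * C) with eps in Hh2 by (field; lra); assumption.
Qed.

(** * The functions [rho] and their moments *)

Lemma Rpower_half_pred x mu : 0 < x -> Rpower x ((mu - 1) / 2) = Rpower x (mu / 2) / sqrt x.
Proof.
  intros Hx; replace ((mu - 1) / 2) with (mu / 2 + - / 2) by field.
  now rewrite Rpower_plus, Rpower_Ropp, Rpower_sqrt.
Qed.

Lemma Rpower_half_succ x mu : 0 < x -> Rpower x ((mu + 1) / 2) = Rpower x (mu / 2) * sqrt x.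
Proof.
  intros Hx; replace ((mu + 1) / 2) with (mu / 2 + / 2) by field.
  now rewrite Rpower_plus, Rpower_sqrt.
Qed.

Lemma is_derive_Rpower s y : 0 < y -> is_derive (fun y => Rpower y s) y (s * Rpower y (s - 1)).
Proof.
  intros Hy; apply is_derive_Reals, derivable_pt_lim_power; assumption.
Qed.

Lemma rho_pos mu x : 0 < x -> 0 < rho mu x.
Proof.
  intros Hx; apply Rmult_lt_0_compat; [apply Rmult_lt_0_compat; [lra|apply exp_pos]|].
  apply BesselK_pos; pose proof (sqrt_lt_R0 x Hx); lra.
Qed.

Lemma rho_rec mu x : 0 < x -> rho (mu + 1) x = mu * rho mu x + x * rho (mu - 1) x.
Proof.
  intros Hx; unfold rho; pose proof (sqrt_lt_R0 x Hx) as Hr.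
  pose proof (BesselK_rec mu (2 * sqrt x) ltac:(lra)) as E.
  rewrite Rpower_half_pred, Rpower_half_succ by assumption.
  set (P := Rpower x (mu / 2)).
  rewrite <- (sqrt_sqrt x) at 4 by lra.
  set (r := sqrt x) in *.
  transitivity (P * (2 * mu * BesselK mu (2 * r)) + 2 * P * r * BesselK (mu - 1) (2 * r));
    [rewrite E; ring|field; lra].
Qed.

(** The derivative of the power contributes a multiple of mu K_mu; rewritten by [BesselK_rec], its
    K_{mu+1} part cancels the one from K_mu'. *)
Lemma rho_derive mu x : 0 < x -> is_derive (rho mu) x (- rho (mu - 1) x).
Proof.
  intros Hx; pose proof (sqrt_lt_R0 x Hx) as Hr.
  pose proof (BesselK_rec mu (2 * sqrt x) ltac:(lra)) as E.
  assert (H1 : is_derive (fun x => BesselK mu (2 * sqrt x)) x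
    (/ sqrt x * (- (BesselK (mu + 1) (2 * sqrt x) + BesselK (mu - 1) (2 * sqrt x)) / 2))).
  { apply (is_derive_comp (BesselK mu) (fun x => 2 * sqrt x)).
    - apply BesselK_derive; lra.
    - auto_derive; [assumption|field; lra]. }
  assert (H2 : is_derive (fun x => 2 * Rpower x (mu / 2)) x (2 * (mu / 2 * Rpower x (mu / 2 - 1)))).
  { apply is_derive_scal, is_derive_Rpower; assumption. }
  pose proof (is_derive_mult _ _ x _ _ H2 H1 Rmult_comm) as H3.
  unfold rho at 1.
  replace (- rho (mu - 1) x) with (plus (mult (2 * (mu / 2 * Rpower x (mu / 2 - 1))) (BesselK mu (2 * sqrt x)))
    (mult (2 * Rpower x (mu / 2))
      (/ sqrt x * (- (BesselK (mu + 1) (2 * sqrt x) + BesselK (mu - 1) (2 * sqrt x)) / 2)))).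
  - exact H3.
  - unfold plus, mult; simpl; unfold rho; rewrite Rpower_half_pred by assumption.
    replace (Rpower x (mu / 2 - 1)) with (Rpower x (mu / 2) / (sqrt x * sqrt x)).
    + set (P := Rpower x (mu / 2)); set (r := sqrt x) in *.
      transitivity (P / (2 * (r * r)) * (2 * mu * BesselK mu (2 * r))
        - P / r * (BesselK (mu + 1) (2 * r) + BesselK (mu - 1) (2 * r))); [field; lra|].
      rewrite E; field; lra.
    + rewrite sqrt_sqrt by lra; unfold Rminus.
      rewrite Rpower_plus, Rpower_Ropp, Rpower_1 by assumption; reflexivity.
Qed.

Lemma rho_le mu M : Rabs mu < M -> exists C, forall x, 0 < x ->
  rho mu x <= C * Rpower x (mu / 2 - M / 2).
Proof.
  intros HM; destruct (BesselK_spec mu M HM) as [C HC]; exists (2 * C * Rpower 2 (- M)); intros x Hx.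
  pose proof (sqrt_lt_R0 x Hx) as Hr.
  destruct (HC (2 * sqrt x) ltac:(lra)) as [_ [_ Hle]].
  rewrite <- Rpower_mult_distr, <- (Rpower_sqrt x), Rpower_mult in Hle by (assumption || lra).
  replace (mu / 2 - M / 2) with (mu / 2 + / 2 * - M) by field; rewrite Rpower_plus, Rpower_sqrt in *  by assumption.
  unfold rho; pose proof (exp_pos (mu / 2 * ln x)) as HP; fold (Rpower x (mu / 2)) in HP.
  apply (Rmult_le_compat_l (2 * Rpower x (mu / 2))) in Hle; lra.
Qed.

Lemma Rpower_rho_lim_0 b mu : 0 < b -> 0 <= mu ->
  filterlim (fun x => Rpower x b * rho mu x) (at_right 0) (locally 0).
Proof.
  (* This M leaves the exponent b + mu/2 - (mu + b)/2 = b/2, still positive. *)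
  intros Hb Hmu; destruct (rho_le mu (mu + b)) as [C HC]; [rewrite Rabs_pos_eq; lra|].
  apply filterlim_dominated with (fun x => C * Rpower x (b / 2)); try apply _.
  - exists (mkposreal 1 Rlt_0_1); intros x _ Hx.
    rewrite Rabs_pos_eq by (apply Rmult_le_pos; [left; apply exp_pos|left; now apply rho_pos]).
    replace (b / 2) with (b + (mu / 2 - (mu + b) / 2)) by field; rewrite Rpower_plus.
    specialize (HC x Hx); apply (Rmult_le_compat_l (Rpower x b)) in HC; [lra|left; apply exp_pos].
  - apply filterlim_scal_0; [apply _|apply Rpower_lim_0; lra].
Qed.

Lemma Rpower_rho_lim_infty b mu : 0 < b -> 0 <= mu ->
  filterlim (fun x => Rpower x b * rho mu x) (Rbar_locally p_infty) (locally 0).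
Proof.
  (* This M makes the total exponent exactly -1. *)
  intros Hb Hmu; destruct (rho_le mu (mu + 2 * b + 2)) as [C HC]; [rewrite Rabs_pos_eq; lra|].
  apply filterlim_dominated with (fun x => C * / x); try apply _.
  - exists 0; intros x Hx.
    rewrite Rabs_pos_eq by (apply Rmult_le_pos; [left; apply exp_pos|left; now apply rho_pos]).
    replace (/ x) with (Rpower x (b + (mu / 2 - (mu + 2 * b + 2) / 2))).
    + rewrite Rpower_plus.
      specialize (HC x Hx); apply (Rmult_le_compat_l (Rpower x b)) in HC; [lra|left; apply exp_pos].
    + replace (b + (mu / 2 - (mu + 2 * b + 2) / 2)) with (- (1)) by field.
      now rewrite Rpower_Ropp, Rpower_1.
  - apply filterlim_scal_0; [apply _|apply inv_lim_infty].
Qed.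

(** The integrand is the derivative of x^b (rho_{nu+1} + b rho_nu), a combination chosen so that the
    rho_{nu-1} terms cancel. It ties the moment of exponent b to that of exponent b - 1 by the
    factor b (b + nu). *)
Lemma rho_moment_step b nu : 0 < b -> 0 <= nu ->
  is_RInt_gen (fun x => b * (b + nu) * (Rpower x (b - 1) * rho nu x) - Rpower x b * rho nu x)
    (at_right 0) (Rbar_locally p_infty) 0.
Proof.
  intros Hb Hnu; replace 0 with (0 - 0) at 2 by ring.
  assert (HF : forall x, 0 < x -> is_derive (fun x => Rpower x b * (rho (nu + 1) x + b * rho nu x)) x
    (b * (b + nu) * (Rpower x (b - 1) * rho nu x) - Rpower x b * rho nu x)).
  { intros x Hx.
    pose proof (is_derive_Rpower b x Hx) as H1.
    pose proof (is_derive_plus _ _ x _ _ (rho_derive (nu + 1) x Hx)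
      (is_derive_scal (rho nu) x b _ (rho_derive nu x Hx))) as H2.
    pose proof (is_derive_mult _ _ x _ _ H1 H2 Rmult_comm) as H3.
    replace (b * (b + nu) * (Rpower x (b - 1) * rho nu x) - Rpower x b * rho nu x)
      with (plus (mult (b * Rpower x (b - 1)) (plus (rho (nu + 1) x) (b * rho nu x)))
        (mult (Rpower x b) (plus (- rho (nu + 1 - 1) x) (b * - rho (nu - 1) x)))); [exact H3|].
    unfold plus, mult; simpl.
    replace (nu + 1 - 1) with nu by ring.
    rewrite (rho_rec nu x Hx).
    replace (Rpower x b) with (x * Rpower x (b - 1)).
    - ring.
    - replace b with (1 + (b - 1)) at 2 by ring; rewrite Rpower_plus, Rpower_1 by assumption; reflexivity. }
  apply (is_RInt_gen_derive_lim (at_right 0) (Rlt 0) at_right_0_down (half_line_up 0)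
    (ex_intro _ 1 Rlt_0_1) (fun x => Rpower x b * (rho (nu + 1) x + b * rho nu x))).
  - exact HF.
  - intros x Hx.
    apply (ex_derive_continuous (fun x => b * (b + nu) * (Rpower x (b - 1) * rho nu x) - Rpower x b * rho nu x)).
    pose proof (is_derive_Rpower b x Hx); pose proof (is_derive_Rpower (b - 1) x Hx).
    pose proof (rho_derive nu x Hx).
    apply @ex_derive_minus; [apply ex_derive_scal|]; apply ex_derive_mult; eexists; eassumption.
  - apply (filterlim_ext (fun x => Rpower x b * rho (nu + 1) x + b * (Rpower x b * rho nu x)));
      [intros; ring|].
    apply filterlim_plus_0; [apply _| |apply filterlim_scal_0; [apply _|]]; apply Rpower_rho_lim_0; lra.
  - apply (filterlim_ext (fun x => Rpower x b * rho (nu + 1) x + b * (Rpower x b * rho nu x)));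
      [intros; ring|].
    apply filterlim_plus_0; [apply _| |apply filterlim_scal_0; [apply _|]]; apply Rpower_rho_lim_infty; lra.
Qed.

Lemma is_RInt_gen_ext_pos (f g : R -> R) (l : R) :
  (forall x, 0 < x -> f x = g x) ->
  is_RInt_gen f (at_right 0) (Rbar_locally p_infty) l ->
  is_RInt_gen g (at_right 0) (Rbar_locally p_infty) l.
Proof.
  intros H; apply is_RInt_gen_ext; exists (fun x => 0 < x) (fun x => 0 < x).
  - exists (mkposreal 1 Rlt_0_1); auto.
  - now exists 0.
  - intros u v Hu Hv x Hx; simpl in Hx.
    apply H, Rlt_trans with (2 := proj1 Hx); now apply Rmin_pos.
Qed.

Lemma is_RInt_gen_sumR (Fa Fb : (R -> Prop) -> Prop) {FFa : Filter Fa} {FFb : Filter Fb}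
    n (f : nat -> R -> R) (l : nat -> R) :
  (forall i, (i < n)%nat -> is_RInt_gen (f i) Fa Fb (l i)) ->
  is_RInt_gen (fun x => sumR n (fun i => f i x)) Fa Fb (sumR n l).
Proof.
  induction n as [|n IH]; intros H; simpl.
  - intros P HP; unfold filtermapi; apply filter_forall; intros [a b]; exists 0; split.
    + assert (E : is_RInt (fun _ => 0) a b ((b - a) * 0))
        by exact (is_RInt_const (V := R_NormedModule) a b 0).
      rewrite Rmult_0_r in E; exact E.
    + now apply locally_singleton.
  - apply (is_RInt_gen_plus (fun x => sumR n (fun i => f i x))); auto.
Qed.

(** The moment of x^s against x^al rho_nu, divided by the total mass. *)
Definition rho_moment (nu al : R) (s : nat) : R := poch (al + 1) s * poch (al + nu + 1) s.

Lemma rho_moments nu al M0 : 0 <= nu -> -1 < al ->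
  is_RInt_gen (fun x => Rpower x al * rho nu x) (at_right 0) (Rbar_locally p_infty) M0 ->
  forall s, is_RInt_gen (fun x => Rpower x (al + INR s) * rho nu x)
    (at_right 0) (Rbar_locally p_infty) (M0 * rho_moment nu al s).
Proof.
  intros Hnu Hal H0 s; induction s as [|s IH].
  - unfold rho_moment; simpl; rewrite !Rmult_1_r, Rplus_0_r; assumption.
  - pose proof (pos_INR s) as Hs; set (b := al + INR (S s)).
    assert (Hb : 0 < b) by (unfold b; rewrite S_INR; lra).
    pose proof (rho_moment_step b nu Hb Hnu) as H1.
    apply (is_RInt_gen_scal _ (b * (b + nu))) in IH.
    pose proof (is_RInt_gen_minus _ _ _ _ IH H1) as H2.
    replace (M0 * rho_moment nu al (S s))
      with (minus (scal (b * (b + nu)) (M0 * rho_moment nu al s)) 0).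
    + revert H2; apply is_RInt_gen_ext_all; try apply _.
      intros x; unfold minus, plus, opp, scal; simpl; unfold mult; simpl.
      replace (b - 1) with (al + INR s) by (unfold b; rewrite S_INR; ring); ring.
    + unfold minus, plus, opp, scal; simpl; unfold mult; simpl.
      unfold rho_moment; rewrite !poch_last; unfold b; rewrite S_INR; ring.
Qed.

(** Orthogonality to P_i passes to x^i by triangularity: in a strong induction on i only the top
    term of P_i survives, and its coefficient is positive. *)
Lemma orthogonality_moments nu al a : 0 <= nu -> -1 < al -> (forall n, 0 < a n n) ->
  (forall n m, is_RInt_gen
     (fun x => polyP a n x * polyP a m x * Rpower x al * rho nu x)
     (at_right 0) (Rbar_locally p_infty) (if Nat.eqb n m then 1 else 0)) ->
  forall n i, (i < n)%nat -> sumR (S n) (fun j => a n j * rho_moment nu al (i + j)) = 0.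
Proof.
  intros Hnu Hal Ha Horth n.
  (* The total mass of the weight, forced by the norm 1 of the constant polynomial P_0. *)
  set (M0 := / (a 0%nat 0%nat * a 0%nat 0%nat)).
  pose proof (Ha 0%nat) as Ha0.
  assert (HM0 : 0 < M0) by (apply Rinv_0_lt_compat, Rmult_lt_0_compat; assumption).
  assert (H0 : is_RInt_gen (fun x => Rpower x al * rho nu x) (at_right 0) (Rbar_locally p_infty) M0).
  { pose proof (Horth 0%nat 0%nat) as H; apply (is_RInt_gen_scal _ M0) in H; simpl in H.
    replace M0 with (scal M0 1) by apply Rmult_1_r.
    revert H; apply is_RInt_gen_ext_all; try apply _; intros x.
    unfold scal; simpl; unfold mult; simpl; unfold polyP, M0; simpl; field; lra. }
  pose proof (rho_moments nu al M0 Hnu Hal H0) as Hmom.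
  assert (Hpp : forall i, sumR (S i) (fun i' => a i i' * sumR (S n) (fun j => a n j * rho_moment nu al (i' + j)))
    = if Nat.eqb n i then a 0%nat 0%nat * a 0%nat 0%nat else 0).
  { intros i.
    assert (H : is_RInt_gen (fun x => polyP a n x * polyP a i x * Rpower x al * rho nu x)
      (at_right 0) (Rbar_locally p_infty)
      (sumR (S i) (fun i' => sumR (S n) (fun j => a i i' * a n j * (M0 * rho_moment nu al (i' + j)))))).
    { apply (is_RInt_gen_ext_pos (fun x => sumR (S i) (fun i' => sumR (S n) (fun j =>
         a i i' * a n j * (Rpower x (al + INR (i' + j)) * rho nu x))))).
      - intros x Hx.
          transitivity (polyP a n x * Rpower x al * rho nu x * polyP a i x); [|ring].
          unfold polyP at 2; rewrite <- sumR_scal; apply sumR_ext; intros i' _.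
          transitivity (Rpower x al * rho nu x * (a i i' * x ^ i') * polyP a n x); [|ring].
          unfold polyP; rewrite <- sumR_scal; apply sumR_ext; intros j _.
          rewrite Rpower_plus, Rpower_pow, pow_add by assumption; ring.
      - apply (is_RInt_gen_sumR _ _ (S i) (fun i' x => sumR (S n) (fun j =>
          a i i' * a n j * (Rpower x (al + INR (i' + j)) * rho nu x)))); intros i' _.
        apply (is_RInt_gen_sumR _ _ (S n) (fun j x =>
          a i i' * a n j * (Rpower x (al + INR (i' + j)) * rho nu x))); intros j _.
        apply (is_RInt_gen_scal (fun x => Rpower x (al + INR (i' + j)) * rho nu x)), Hmom. }
    pose proof (eq_trans (eq_sym (is_RInt_gen_unique _ _ H)) (is_RInt_gen_unique _ _ (Horth n i))) as E.
    rewrite (sumR_ext _ _ (fun i' => M0 * (a i i' * sumR (S n) (fun j => a n j * rho_moment nu al (i' + j))))) in E.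
    2:{ intros i' _; rewrite <- !sumR_scal; apply sumR_ext; intros; ring. }
    rewrite sumR_scal in E.
    apply (Rmult_eq_reg_l M0); [rewrite E|lra].
    destruct (Nat.eqb n i); [unfold M0; field; lra|ring]. }
  intros i; induction i as [i IH] using lt_wf_ind; intros Hi.
  specialize (Hpp i); destruct (Nat.eqb_spec n i) as [->|_]; [lia|].
  change (sumR (S i) ?f) with (sumR i f + f i) in Hpp; cbv beta in Hpp.
  rewrite sumR_zero in Hpp by (intros i' Hi'; rewrite IH by lia; ring).
  pose proof (Ha i).
  apply (Rmult_eq_reg_l (a i i)); lra.
Qed.

(** * The Gamma function and the coefficients c_{n,k} *)

(** Since e^{-t} <= C (1+t)^{-(s+1)}, the integrand is below a multiple of the derivative of
    (t/(1+t))^s. This primitive is bounded on the half-line, so a single majorant handles both 0 and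
    infinity. *)
Lemma Gamma_spec s : 0 < s ->
  is_RInt_gen (fun t => Rpower t (s - 1) * exp (- t)) (at_right 0) (Rbar_locally p_infty) (Gamma s)
  /\ 0 < Gamma s.
Proof.
  intros Hs.
  set (C := exp ((s + 1) * ln ((s + 1) / 1)) * exp 1).
  assert (HC : 0 < C) by (apply Rmult_lt_0_compat; apply exp_pos).
  assert (Hcont : forall t, 0 < t -> continuous (fun t => Rpower t (s - 1) * exp (- t)) t).
  { intros t Ht; apply (ex_derive_continuous (fun t => Rpower t (s - 1) * exp (- t))).
    unfold Rpower; auto_derive; auto. }
  destruct (is_RInt_gen_dominated (at_right 0) (Rlt 0) at_right_0_down (half_line_up 0)
    (ex_intro _ 1 Rlt_0_1) (fun t => Rpower t (s - 1) * exp (- t))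
    (fun t => C * (Rpower (t / (1 + t)) (s - 1) * / (1 + t) ^ 2))
    (fun t => C / s * Rpower (t / (1 + t)) s) (C / s)) as (l & Hl & Hlow & _).
  - exact Hcont.
  - intros t Ht; apply (ex_derive_continuous (fun t => C * (Rpower (t / (1 + t)) (s - 1) * / (1 + t) ^ 2))).
    unfold Rpower; auto_derive.
    assert (0 < t / (1 + t)) by (apply Rdiv_lt_0_compat; lra).
    repeat split; try lra; try (apply Rmult_integral_contrapositive_currified; lra); try assumption.
  - intros t Ht; split; [left; apply Rmult_lt_0_compat; apply exp_pos|].
    pose proof (Rpower_exp_le (s + 1) 1 ltac:(lra) Rlt_0_1 (1 + t) ltac:(lra)) as E.
    replace (Rpower (t / (1 + t)) (s - 1) * / (1 + t) ^ 2)
      with (Rpower t (s - 1) * / Rpower (1 + t) (s + 1)).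
    + assert (Hp : 0 < Rpower (1 + t) (s + 1)) by apply exp_pos.
      apply Rmult_le_reg_r with (1 := Hp).
      replace (C * (Rpower t (s - 1) * / Rpower (1 + t) (s + 1)) * Rpower (1 + t) (s + 1))
        with (Rpower t (s - 1) * C) by (field; lra).
      rewrite Rmult_assoc; apply Rmult_le_compat_l; [left; apply exp_pos|].
      replace (exp (- t)) with (exp (- (1) * (1 + t)) * exp 1) by (rewrite <- exp_plus; f_equal; ring).
      unfold C; pose proof (exp_pos 1); nra.
    + assert (E1 : Rpower (/ (1 + t)) (s - 1) = / Rpower (1 + t) (s - 1)).
      { rewrite <- Rpower_Ropp; unfold Rpower; rewrite ln_Rinv by lra; f_equal; ring. }
      assert (E2 : Rpower (1 + t) (s + 1) = Rpower (1 + t) (s - 1) * (1 + t) ^ 2).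
      { rewrite <- Rpower_pow, <- Rpower_plus by lra; f_equal; simpl; ring. }
      unfold Rdiv; rewrite <- Rpower_mult_distr by (try apply Rinv_0_lt_compat; lra).
      rewrite E1, E2; pose proof (exp_pos ((s - 1) * ln (1 + t))) as HP.
      fold (Rpower (1 + t) (s - 1)) in HP; field; lra.
  - intros t Ht.
    assert (Hq : 0 < t / (1 + t)) by (apply Rdiv_lt_0_compat; lra).
    pose proof (is_derive_comp (fun y => Rpower y s) (fun t => t / (1 + t)) t _ (/ (1 + t) ^ 2)
      (is_derive_Rpower s _ Hq)) as H1.
    assert (H2 : is_derive (fun t => t / (1 + t)) t (/ (1 + t) ^ 2)).
    { auto_derive; [lra|field; lra]. }
    specialize (H1 H2); apply (is_derive_scal _ t (C / s)) in H1.
    replace (C * (Rpower (t / (1 + t)) (s - 1) * / (1 + t) ^ 2))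
      with (C / s * scal (/ (1 + t) ^ 2) (s * Rpower (t / (1 + t)) (s - 1))).
    + exact H1.
    + unfold scal; simpl; unfold mult; simpl; field; lra.
  - intros u v Hu Hv.
    assert (HB : forall t, 0 < t -> 0 < Rpower (t / (1 + t)) s <= 1).
    { intros t Ht; split; [apply exp_pos|].
      assert (Hq : 0 < t / (1 + t)) by (apply Rdiv_lt_0_compat; lra).
      assert (E1 : Rpower 1 s = 1) by (unfold Rpower; rewrite ln_1, Rmult_0_r; apply exp_0).
      rewrite <- E1 at 2; apply Rle_Rpower_l; [lra|split; [exact Hq|]].
      apply Rmult_le_reg_r with (1 + t); [lra|].
      unfold Rdiv; rewrite Rmult_assoc, Rinv_l; lra. }
    pose proof (HB u Hu); pose proof (HB v Hv).
    assert (0 < C / s) by (apply Rdiv_lt_0_compat; assumption); nra.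
  - assert (El : Gamma s = l) by (apply is_RInt_gen_unique; exact Hl).
    rewrite El; split; [exact Hl|].
    apply Rlt_le_trans with (2 := Hlow 1 2 Rlt_0_1 ltac:(lra)).
    apply RInt_gt_0; [lra| |].
    + intros; apply Rmult_lt_0_compat; apply exp_pos.
    + intros x Hx; apply Hcont; lra.
Qed.

Lemma Gamma_S s : 0 < s -> Gamma (s + 1) = s * Gamma s.
Proof.
  intros Hs.
  destruct (Gamma_spec s Hs) as [H0 _]; destruct (Gamma_spec (s + 1) ltac:(lra)) as [H1 _].
  apply (is_RInt_gen_scal _ s) in H0.
  pose proof (is_RInt_gen_minus _ _ _ _ H0 H1) as H2.
  assert (H3 : is_RInt_gen (fun t => s * (Rpower t (s - 1) * exp (- t)) - Rpower t (s + 1 - 1) * exp (- t))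
    (at_right 0) (Rbar_locally p_infty) (0 - 0)).
  { apply (is_RInt_gen_derive_lim (at_right 0) (Rlt 0) at_right_0_down (half_line_up 0)
      (ex_intro _ 1 Rlt_0_1) (fun t => Rpower t s * exp (- t))).
    - intros t Ht; replace (s + 1 - 1) with s by ring.
      assert (H4 : is_derive (fun t => exp (- t)) t (- exp (- t))) by (auto_derive; auto; ring).
      pose proof (is_derive_mult _ _ t _ _ (is_derive_Rpower s t Ht) H4 Rmult_comm) as H5.
      replace (s * (Rpower t (s - 1) * exp (- t)) - Rpower t s * exp (- t))
        with (plus (mult (s * Rpower t (s - 1)) (exp (- t))) (mult (Rpower t s) (- exp (- t)))).
      + exact H5.
      + unfold plus, mult; simpl; ring.
    - intros t Ht.
      apply (ex_derive_continuous (fun t => s * (Rpower t (s - 1) * exp (- t)) - Rpower t (s + 1 - 1) * exp (- t))).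
      unfold Rpower; auto_derive; auto.
    - apply filterlim_dominated with (fun t => Rpower t s); [apply _| |now apply Rpower_lim_0].
      exists (mkposreal 1 Rlt_0_1); intros t _ Ht.
      rewrite Rabs_pos_eq by (left; apply Rmult_lt_0_compat; apply exp_pos).
      rewrite <- (Rmult_1_r (Rpower t s)) at 2; apply Rmult_le_compat_l; [left; apply exp_pos|].
      rewrite <- exp_0; apply exp_le_mono; lra.
    - apply filterlim_dominated with (fun t => exp ((s + 1) * ln ((s + 1) / 1)) * / t); [apply _| |].
      + exists 0; intros t Ht.
        rewrite Rabs_pos_eq by (left; apply Rmult_lt_0_compat; apply exp_pos).
        pose proof (Rpower_exp_le (s + 1) 1 ltac:(lra) Rlt_0_1 t Ht) as E.
        rewrite Rpower_plus, Rpower_1 in E by assumption.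
        replace (- (1) * t) with (- t) in E by ring.
        apply Rmult_le_reg_r with t; [assumption|].
        rewrite (Rmult_assoc _ (/ t)), Rinv_l by lra; lra.
      + apply filterlim_scal_0; [apply _|apply inv_lim_infty]. }
  assert (E : s * Gamma s - Gamma (s + 1) = 0 - 0).
  { rewrite <- (is_RInt_gen_unique _ _ H3); symmetry; exact (is_RInt_gen_unique _ _ H2). }
  lra.
Qed.

Lemma Gamma_poch s n : 0 < s -> Gamma (s + INR n) = Gamma s * poch s n.
Proof.
  intros Hs; induction n as [|n IH]; [simpl; rewrite Rplus_0_r; ring|].
  rewrite S_INR, <- Rplus_assoc, Gamma_S by (pose proof (pos_INR n); lra).
  rewrite IH, poch_last; ring.
Qed.

Lemma gamma_moment b m : -1 < b ->
  is_RInt_gen (fun t => Rpower t b * exp (- t) * t ^ m) (at_right 0) (Rbar_locally p_infty)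
    (Gamma (b + 1) * poch (b + 1) m).
Proof.
  intros Hb; pose proof (pos_INR m) as Hm.
  rewrite <- Gamma_poch by lra.
  destruct (Gamma_spec (b + 1 + INR m) ltac:(lra)) as [H _]; revert H.
  apply is_RInt_gen_ext_pos; intros x Hx.
  replace (b + 1 + INR m - 1) with (b + INR m) by ring.
  rewrite Rpower_plus, Rpower_pow by assumption; ring.
Qed.

Lemma is_RInt_gen_Qlin (Fa Fb : (R -> Prop) -> Prop) {FFa : Filter Fa} {FFb : Filter Fb}
    a nu n (f : nat -> R -> R) (l : nat -> R) :
  (forall m, is_RInt_gen (f m) Fa Fb (l m)) ->
  is_RInt_gen (fun t => Qlin a nu n (fun m => f m t)) Fa Fb (Qlin a nu n l).
Proof.
  intros H; unfold Qlin.
  apply (is_RInt_gen_sumR _ _ (S n) (fun j t => a n j * ((-1) ^ j * sumR (S j) (fun i => lag nu j i * f (j + i)%nat t)))).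
  intros j _.
  apply (is_RInt_gen_scal (fun t => (-1) ^ j * sumR (S j) (fun i => lag nu j i * f (j + i)%nat t)) (a n j)).
  apply (is_RInt_gen_scal (fun t => sumR (S j) (fun i => lag nu j i * f (j + i)%nat t)) ((-1) ^ j)).
  apply (is_RInt_gen_sumR _ _ (S j) (fun i t => lag nu j i * f (j + i)%nat t)); intros i _.
  apply (is_RInt_gen_scal (f (j + i)%nat) (lag nu j i)), H.
Qed.

(** The left side is the integral of t^m k! L_k^b against t^b e^{-t}, divided by Gamma(b+1).
    Chu-Vandermonde evaluates it to (b+1)_m (-m)_k, which vanishes for m < k and otherwise is a
    multiple of the expansion coefficient [lag b m k]. *)
Lemma lag_gamma_moment b k m :
  sumR (S k) (fun i => lag b k i * poch (b + 1) (m + i))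
  = INR (fact k) * poch (b + 1) k * lag b m k.
Proof.
  transitivity (poch (b + 1) m * poch (- INR m) k).
  { replace (- INR m) with (b + 1 - (b + 1 + INR m)) by ring.
    rewrite <- vandermonde, <- sumR_scal; apply sumR_ext; intros i _; unfold lag.
    rewrite poch_add; replace (b + INR i + 1) with (b + 1 + INR i) by ring; ring. }
  pose proof (bin_poch m 0 k) as E; rewrite bin_0 in E.
  pose proof (poch_fact 0 k) as F.
  change (fact 0) with 1%nat in F; change (0 + k)%nat with k in *; change (INR 0) with 0 in *.
  change (INR 1) with 1 in F; rewrite Rmult_1_r in F; rewrite F in E.
  replace (- (INR m - 0)) with (- INR m) in E by ring.
  assert (Es : (-1) ^ k * (-1) ^ k = 1)
    by (rewrite <- Rpow_mult_distr; replace (-1 * -1) with 1 by ring; apply pow1).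
  assert (E' : poch (- INR m) k = (-1) ^ k * (bin m k * INR (fact k))) by (rewrite E; ring [Es]).
  rewrite E'; unfold lag; destruct (Nat.le_gt_cases k m) as [H|H].
  - replace m with (k + (m - k))%nat at 1 by lia; rewrite poch_add.
    replace (b + 1 + INR k) with (b + INR k + 1) by ring; ring.
  - rewrite bin_gt by assumption; ring.
Qed.

(** Identifies the integral defining c_{n,k} with k! times the algebraic coefficient of
    [Qlin_expand], by integrating monomials; the Gamma factor in the definition cancels the norm. *)
Lemma cnk_Qlin a nu al n k : -1 < nu + al ->
  cnk a nu al n k = INR (fact k) * Qlin a nu n (fun m => lag (nu + al) m k).
Proof.
  intros Hb; unfold cnk; set (b := nu + al) in *.
  assert (H : is_RInt_gen (fun t => Rpower t b * exp (- t) * Qassoc a nu n t * Laguerre k b t)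
    (at_right 0) (Rbar_locally p_infty)
    (Gamma (b + 1) * poch (b + 1) k * Qlin a nu n (fun m => lag b m k))).
  { replace (Gamma (b + 1) * poch (b + 1) k * Qlin a nu n (fun m => lag b m k))
      with (sumR (S k) (fun i => lag b k i / INR (fact k) * Qlin a nu n (fun m => Gamma (b + 1) * poch (b + 1) (m + i)))).
    - apply (is_RInt_gen_ext_all _ _ (fun t => sumR (S k) (fun i => lag b k i / INR (fact k)
        * Qlin a nu n (fun m => Rpower t b * exp (- t) * t ^ (m + i))))).
      + intros t.
        rewrite (sumR_ext _ _ (fun i => Rpower t b * exp (- t) * Qassoc a nu n t / INR (fact k) * (lag b k i * t ^ i))).
        * rewrite sumR_scal, <- lag_Laguerre; field; apply INR_fact_neq_0.
        * intros i _; rewrite Qassoc_Qlin.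
          rewrite (Qlin_ext a nu n _ (fun m => (Rpower t b * exp (- t) * t ^ i) * t ^ m)).
          -- rewrite Qlin_scal; unfold Rdiv; ring.
          -- intros m _; rewrite pow_add; ring.
      + apply (is_RInt_gen_sumR _ _ (S k) (fun i t => lag b k i / INR (fact k)
          * Qlin a nu n (fun m => Rpower t b * exp (- t) * t ^ (m + i)))); intros i _.
        apply (is_RInt_gen_scal (fun t => Qlin a nu n (fun m => Rpower t b * exp (- t) * t ^ (m + i))) (lag b k i / INR (fact k))).
        apply (is_RInt_gen_Qlin _ _ a nu n (fun m t => Rpower t b * exp (- t) * t ^ (m + i))).
        intros m; now apply gamma_moment.
    - rewrite (sumR_ext _ _ (fun i => Qlin a nu n (fun m => Gamma (b + 1) / INR (fact k) * (lag b k i * poch (b + 1) (m + i))))).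
      + rewrite <- Qlin_sum, <- Qlin_scal; apply Qlin_ext; intros m _.
        rewrite sumR_scal, lag_gamma_moment; field; apply INR_fact_neq_0.
      + intros i _; rewrite <- Qlin_scal; apply Qlin_ext; intros m _; unfold Rdiv; ring. }
  rewrite (is_RInt_gen_unique _ _ H).
  replace (INR k + nu + al + 1) with (b + 1 + INR k) by (unfold b; ring).
  rewrite Gamma_poch by lra.
  pose proof (proj2 (Gamma_spec (b + 1) ltac:(lra))); pose proof (poch_pos (b + 1) k ltac:(lra)).
  field; lra.
Qed.

(** The comparison of the two weights. For each j, Chu-Vandermonde gives (-(al+i+j))_j = (-1)^j
    (al+1+i)_j, and (al+1)_i completes it to (al+1)_{i+j}. *)
Lemma Qlin_gamma_moment a nu al n i :
  poch (al + 1) i * Qlin a nu n (fun m => poch (nu + al + 1) (m + i))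
  = sumR (S n) (fun j => a n j * rho_moment nu al (i + j)).
Proof.
  unfold Qlin; rewrite <- sumR_scal; apply sumR_ext; intros j _.
  rewrite (sumR_ext _ _ (fun r => poch (nu + al + 1) (i + j) * ((-1) ^ r * bin j r
    * poch (nu + al + 1 + INR (i + j)) r * poch (nu + 1 + INR r) (j - r)))).
  2:{ intros r _; unfold lag; replace (j + r + i)%nat with (i + j + r)%nat by lia.
      rewrite (poch_add _ (i + j)); replace (nu + INR r + 1) with (nu + 1 + INR r) by ring; ring. }
  rewrite sumR_scal, vandermonde.
  replace (nu + 1 - (nu + al + 1 + INR (i + j))) with (- (al + INR (i + j))) by ring.
  pose proof (poch_reflect (al + INR (i + j)) j) as E.
  replace (al + INR (i + j) - INR j + 1) with (al + 1 + INR i) in E by (rewrite plus_INR; ring).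
  unfold rho_moment; rewrite (poch_add (al + 1)), E.
  replace (al + nu + 1) with (nu + al + 1) by ring; ring.
Qed.

(** Up to the nonzero factor k! (nu+al+1)_k, the coefficient is a combination of the Gamma moments
    of t^i Q_{2n} with i <= k < n, each of which is a moment of x^i P_n and so vanishes. *)
Lemma cnk_low a nu al : 0 <= nu -> -1 < al -> (forall n, 0 < a n n) ->
  (forall n m, is_RInt_gen
     (fun x => polyP a n x * polyP a m x * Rpower x al * rho nu x)
     (at_right 0) (Rbar_locally p_infty) (if Nat.eqb n m then 1 else 0)) ->
  forall n k, (k < n)%nat -> cnk a nu al n k = 0.
Proof.
  intros Hnu Hal Ha Horth n k Hk; rewrite cnk_Qlin by lra.
  assert (Hz : Qlin a nu n (fun m => INR (fact k) * poch (nu + al + 1) k * lag (nu + al) m k) = 0).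
  { rewrite (Qlin_ext a nu n _ (fun m => sumR (S k) (fun i => lag (nu + al) k i * poch (nu + al + 1) (m + i))))
      by (intros; now rewrite lag_gamma_moment).
    rewrite Qlin_sum; apply sumR_zero; intros i Hi; rewrite Qlin_scal.
    pose proof (Qlin_gamma_moment a nu al n i) as E.
    rewrite (orthogonality_moments nu al a) in E by (assumption || lia).
    pose proof (poch_pos (al + 1) i ltac:(lra)).
    apply Rmult_integral in E; destruct E as [E|E]; [lra|rewrite E; ring]. }
  rewrite Qlin_scal in Hz; pose proof (poch_pos (nu + al + 1) k ltac:(lra)).
  apply Rmult_integral in Hz; destruct Hz as [Hz|Hz]; [|rewrite Hz; ring].
  apply Rmult_integral in Hz; pose proof (INR_fact_lt_0 k); destruct Hz; lra.
Qed.

Lemma polyP_leibniz a nu al : 0 <= nu -> -1 < al -> (forall n, 0 < a n n) ->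
  (forall n m, is_RInt_gen
     (fun x => polyP a n x * polyP a m x * Rpower x al * rho nu x)
     (at_right 0) (Rbar_locally p_infty) (if Nat.eqb n m then 1 else 0)) ->
  forall n x u, rec_seq nu x u ->
  polyP a n x * u 0%Z
  = sumR (S n) (fun t => cnk a nu al n (n + t) / INR (fact (n + t)) * leibniz al (n + t) x u).
Proof.
  intros Hnu Hal Ha Horth n x u Hu; rewrite (polyP_expand a nu al n x u Hu).
  replace (S (2 * n)) with (n + S n)%nat by lia.
  rewrite sumR_app, sumR_zero, Rplus_0_l.
  - apply sumR_ext; intros t _; rewrite cnk_Qlin by lra; field; apply INR_fact_neq_0.
  - intros k Hk; pose proof (cnk_low a nu al Hnu Hal Ha Horth n k Hk) as E.
    rewrite cnk_Qlin in E by lra; apply Rmult_integral in E.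
    destruct E as [E|E]; [now apply INR_fact_neq_0 in E|rewrite E; ring].
Qed.

Lemma polyP_lommel a nu al : 0 <= nu -> -1 < al -> (forall n, 0 < a n n) ->
  (forall n m, is_RInt_gen
     (fun x => polyP a n x * polyP a m x * Rpower x al * rho nu x)
     (at_right 0) (Rbar_locally p_infty) (if Nat.eqb n m then 1 else 0)) ->
  forall n x, 0 < x ->
  polyP a n x = sumR (S n) (fun t => cnk a nu al n (n + t) / INR (fact (n + t))
    * sumR (S (n + t)) (fun p => lag al (n + t) p * lommel nu p x)).
Proof.
  intros Hnu Hal Ha Horth n x Hx.
  transitivity (polyP a n x * unit_seq nu x 0%Z); [unfold unit_seq; simpl; ring|].
  rewrite (polyP_leibniz a nu al Hnu Hal Ha Horth n x _ (unit_seq_rec nu x ltac:(lra))).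
  apply sumR_ext; intros t _; now rewrite leibniz_unit_seq by lra.
Qed.

(** * Differentiation of the Leibniz sums and assembly *)

Definition rho_seq (nu x : R) (z : Z) : R := rho (nu + IZR z) x.

Lemma rho_seq_rec nu x : 0 < x -> rec_seq nu x (rho_seq nu x).
Proof.
  intros Hx z; unfold rho_seq; rewrite plus_IZR, minus_IZR.
  replace (nu + (IZR z + 1)) with (nu + IZR z + 1) by ring.
  replace (nu + (IZR z - 1)) with (nu + IZR z - 1) by ring.
  now apply rho_rec.
Qed.

Lemma is_derive_sumR n (f df : nat -> R -> R) y :
  (forall i, (i < n)%nat -> is_derive (f i) y (df i y)) ->
  is_derive (fun y => sumR n (fun i => f i y)) y (sumR n (fun i => df i y)).
Proof.
  induction n as [|n IH]; intros H; simpl.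
  - apply (is_derive_const (0 : R)).
  - apply (is_derive_plus (fun y => sumR n (fun i => f i y))); auto.
Qed.

(** One more derivative of (x^{k+s} rho_nu)^{(k)}, now written with exponent (k + 1) + (s - 1). On
    coefficients this is the recurrence [lag_S_S]. *)
Lemma leibniz_derive nu s k y : 0 < y ->
  is_derive (fun y => Rpower y s * leibniz s k y (rho_seq nu y)) y
    (Rpower y (s - 1) * leibniz (s - 1) (S k) y (rho_seq nu y)).
Proof.
  intros Hy.
  apply (is_derive_ext_loc (fun y => sumR (S k) (fun p =>
    lag s k p * (Rpower y (s + INR p) * rho (nu - INR p) y)))).
  { exists (mkposreal y Hy); intros t Ht.
    change (Rabs (t - y) < y) in Ht; apply Rabs_def2 in Ht.
    unfold leibniz; rewrite <- sumR_scal; apply sumR_ext; intros p _.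
    unfold rho_seq; rewrite opp_IZR, <- INR_IZR_INZ, Rpower_plus, Rpower_pow by lra.
    replace (nu + - INR p) with (nu - INR p) by ring; ring. }
  replace (Rpower y (s - 1) * leibniz (s - 1) (S k) y (rho_seq nu y)) with
    (sumR (S k) (fun p => lag s k p * ((s + INR p) * Rpower y (s + INR p - 1) * rho (nu - INR p) y
      + Rpower y (s + INR p) * - rho (nu - INR p - 1) y))).
  - apply (is_derive_sumR (S k)
      (fun p y => lag s k p * (Rpower y (s + INR p) * rho (nu - INR p) y))
      (fun p y => lag s k p * ((s + INR p) * Rpower y (s + INR p - 1) * rho (nu - INR p) y
        + Rpower y (s + INR p) * - rho (nu - INR p - 1) y))).
    intros p _; apply is_derive_scal.
    exact (is_derive_mult _ _ y _ _ (is_derive_Rpower (s + INR p) y Hy)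
      (rho_derive (nu - INR p) y Hy) Rmult_comm).
  - unfold leibniz; rewrite <- sumR_scal, (sumR_first (S k)).
    set (w := fun p : nat => Rpower y (s - 1) * (y ^ p * rho (nu - INR p) y)).
    transitivity (sumR (S k) (fun p => (s + INR p) * lag s k p * w p)
      + sumR (S k) (fun p => - lag s k p * w (S p))).
    + rewrite <- sumR_plus; apply sumR_ext; intros p _; unfold w.
      replace (s + INR p - 1) with (s - 1 + INR p) by ring.
      replace (Rpower y (s + INR p)) with (Rpower y (s - 1 + INR p + 1)) by (f_equal; ring).
      rewrite !(Rpower_plus), Rpower_pow, Rpower_1, S_INR by assumption.
      replace (nu - (INR p + 1)) with (nu - INR p - 1) by ring; simpl pow; ring.
    + rewrite <- (sumR_extend (S k) (S (S k)) (fun p => (s + INR p) * lag s k p * w p)).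
      2: lia. 2: intros i Hi; rewrite lag_gt by lia; ring.
      rewrite (sumR_first (S k)), Rplus_assoc, <- sumR_plus, lag_S_0.
      replace (s - 1 + 1) with s by ring.
      f_equal.
      * unfold w, rho_seq; simpl INR; simpl pow; simpl (- Z.of_nat 0)%Z.
        replace (nu + 0) with (nu - 0) by ring; ring.
      * apply sumR_ext; intros p _; rewrite lag_S_S.
        replace (s - 1 + 1) with s by ring.
        unfold w, rho_seq; rewrite opp_IZR, <- INR_IZR_INZ.
        replace (nu + - INR (S p)) with (nu - INR (S p)) by ring; ring.
Qed.

Lemma leibniz_Derive_n nu n s (c : nat -> R) k : forall y, 0 < y ->
  Derive_n (fun y => Rpower y s * sumR n (fun j => c j * leibniz s j y (rho_seq nu y))) k y
  = Rpower y (s - INR k)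
    * sumR n (fun j => c j * leibniz (s - INR k) (j + k) y (rho_seq nu y)).
Proof.
  induction k as [|k IH]; intros y Hy.
  - simpl; rewrite Rminus_0_r; f_equal; apply sumR_ext; intros j _; now rewrite Nat.add_0_r.
  - change (Derive_n ?f (S k) y) with (Derive (Derive_n f k) y).
    rewrite (Derive_ext_loc _ (fun y => sumR n (fun j => c j *
      (Rpower y (s - INR k) * leibniz (s - INR k) (j + k) y (rho_seq nu y))))).
    + apply is_derive_unique.
      replace (Rpower y (s - INR (S k)) * sumR n (fun j => c j * leibniz (s - INR (S k)) (j + S k) y (rho_seq nu y)))
        with (sumR n (fun j => c j * (Rpower y (s - INR k - 1) * leibniz (s - INR k - 1) (S (j + k)) y (rho_seq nu y)))).
      * apply (is_derive_sumR n
          (fun j y => c j * (Rpower y (s - INR k) * leibniz (s - INR k) (j + k) y (rho_seq nu y)))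
          (fun j y => c j * (Rpower y (s - INR k - 1) * leibniz (s - INR k - 1) (S (j + k)) y (rho_seq nu y)))).
        intros j _; now apply is_derive_scal, leibniz_derive.
      * rewrite <- sumR_scal; apply sumR_ext; intros j _.
        replace (s - INR (S k)) with (s - INR k - 1) by (rewrite S_INR; ring).
        rewrite Nat.add_succ_r; ring.
    (* The induction hypothesis is needed on a neighbourhood of y; radius y keeps it inside the
       positive half-line. *)
    + exists (mkposreal y Hy); intros t Ht.
      change (Rabs (t - y) < y) in Ht; apply Rabs_def2 in Ht.
      rewrite IH, <- sumR_scal by lra; apply sumR_ext; intros; ring.
Qed.

(* a n k = coefficient of x^k in P_n^{nu,alpha}; the hypotheses say exactly
   that (polyP a n)_n is the orthonormal system with positive leading
   coefficients w.r.t. x^alpha rho_nu(x) dx on (0,oo). *)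
Theorem theorem3 (nu alpha : R) (a : nat -> nat -> R) :
  0 <= nu -> -1 < alpha ->
  (forall n, 0 < a n n) ->
  (forall n m, is_RInt_gen
     (fun x => polyP a n x * polyP a m x * Rpower x alpha * rho nu x)
     (at_right 0) (Rbar_locally p_infty) (if Nat.eqb n m then 1 else 0)) ->
  forall (n : nat) (x : R), 0 < x ->
    polyP a n x =
      Rpower x (- alpha) / rho nu x *
      Derive_n (fun y => Rpower y (INR n + alpha) *
                  (rho nu y * S1 a nu alpha n y + rho (nu + 1) y * S2 a nu alpha n y))
               n x
 /\ polyP a (2 * n) x =
      sumR (n + 1) (fun t => let j := (n + t)%nat in
        cnk a nu alpha (2 * n) (2 * j) / INR (fact (2 * j)) * A_jjm1 nu alpha j x)
    + sumR n (fun t => let j := (n + t)%nat in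
        cnk a nu alpha (2 * n) (2 * j + 1) / INR (fact (2 * j + 1)) * A_jj nu alpha j x)
 /\ polyP a (2 * n + 1) x =
      sumR (n + 1) (fun t => let j := (n + t)%nat in
        cnk a nu alpha (2 * n + 1) (2 * (j + 1)) / INR (fact (2 * (j + 1)))
          * A_jjm1 nu alpha (j + 1) x
      + cnk a nu alpha (2 * n + 1) (2 * j + 1) / INR (fact (2 * j + 1))
          * A_jj nu alpha j x).
Proof.
  intros Hnu Hal Ha Horth n x Hx.
  assert (Hpair : forall N f, sumR (2 * N) f = sumR N (fun t => f (2 * t)%nat + f (2 * t + 1)%nat)).
  { intros N f; induction N as [|N IH]; [reflexivity|].
    replace (2 * S N)%nat with (S (S (2 * N))) by lia; simpl sumR at 1.
    change (sumR (S N) ?g) with (sumR N g + g N); cbv beta; rewrite <- IH.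
    replace (2 * N + 1)%nat with (S (2 * N)) by lia; simpl; ring. }
  split; [|split].
  - rewrite (Derive_n_ext_loc _ (fun y => Rpower y (INR n + alpha) * sumR (S n) (fun j =>
      cnk a nu alpha n (j + n) / INR (fact (j + n)) * leibniz (INR n + alpha) j y (rho_seq nu y)))).
    (* The n outer derivatives lower the exponent n + alpha to alpha and raise the order j to j +
       n. *)
    + rewrite leibniz_Derive_n by assumption.
      replace (INR n + alpha - INR n) with alpha by ring.
      pose proof (polyP_leibniz a nu alpha Hnu Hal Ha Horth n x _ (rho_seq_rec nu x Hx)) as E.
      unfold rho_seq at 1 in E; rewrite Rplus_0_r in E.
      rewrite (sumR_ext _ (fun j => cnk a nu alpha n (j + n) / _ * _) (fun t =>
        cnk a nu alpha n (n + t) / INR (fact (n + t)) * leibniz alpha (n + t) x (rho_seq nu x)))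
        by (intros j _; now rewrite (Nat.add_comm j n)).
      rewrite <- E, Rpower_Ropp.
      pose proof (rho_pos nu x Hx); assert (0 < Rpower x alpha) by apply exp_pos.
      field; lra.
    + exists (mkposreal x Hx); intros y Hy.
      change (Rabs (y - x) < x) in Hy; apply Rabs_def2 in Hy.
      rewrite <- (S1_S2_leibniz a nu alpha n y (rho_seq nu y) (rho_seq_rec nu y ltac:(lra))).
      unfold rho_seq; now rewrite Rplus_0_r.
  - rewrite (polyP_lommel a nu alpha Hnu Hal Ha Horth) by assumption.
    (* The indices 2n, ..., 4n are odd in number. The last one is split off before pairing, so the
       even indices have one term more than the odd ones. *)
    change (sumR (S (2 * n)) ?f) with (sumR (2 * n) f + f (2 * n)%nat); rewrite Hpair, sumR_plus.
    rewrite Nat.add_1_r; change (sumR (S n) ?f) with (sumR n f + f n); cbv beta zeta.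
    rewrite A_jjm1_lommel by assumption.
    replace (2 * (n + n))%nat with (2 * n + 2 * n)%nat by lia.
    rewrite Rplus_assoc, (Rplus_comm (sumR n _) (_ * _)), <- Rplus_assoc; f_equal; [f_equal|];
      apply sumR_ext; intros t _.
    + rewrite A_jjm1_lommel by assumption.
      now replace (2 * (n + t))%nat with (2 * n + 2 * t)%nat by lia.
    + rewrite A_jj_lommel by assumption.
      now replace (2 * (n + t) + 1)%nat with (2 * n + (2 * t + 1))%nat by lia.
  - rewrite (polyP_lommel a nu alpha Hnu Hal Ha Horth) by assumption.
    (* Here the indices 2n+1, ..., 4n+2 pair off exactly as (2j+1, 2(j+1)) with j = n + t. *)
    replace (S (2 * n + 1)) with (2 * (n + 1))%nat by lia; rewrite Hpair.
    apply sumR_ext; intros t _; cbv zeta.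
    rewrite A_jjm1_lommel, A_jj_lommel by assumption.
    replace (2 * (n + t + 1))%nat with (2 * n + 1 + (2 * t + 1))%nat by lia.
    replace (2 * (n + t) + 1)%nat with (2 * n + 1 + 2 * t)%nat by lia; ring.
Qed.
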